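(* Consider a generalized linear mixed model with discrete responses $y=(y_1,\dots,y_N)$, parameter vector $\theta=(\theta_c)_{1\le c\le d}$, parameter space $\Theta$ a convex subset of $\mathbb{R}^d$, true parameter vector $\theta_0$, and subsets of the data with clusters $y_{a,j}$, $1\le j\le m_a$, $1\le a\le b$, as described in the context. Suppose that: (A1) for each $1\le a\le b$, the vectors $y_{a,j}$, $1\le j\le m_a$, are independent, with $m_a\to\infty$ as $N\to\infty$. Suppose that, for any fixed $M>0$, the following (B2) and (B3) hold: (B2) $\theta_0\in\Theta^{\mathrm{o}}$, the interior of $\Theta$, and for every $\varepsilon>0$, $$\limsup_{N\to\infty}\ \sup_{\theta\in\Theta,\ \varepsilon\le|\theta-\theta_0|\le M}\ \min_{1\le a\le b}\frac{1}{m_a}\sum_{j=1}^{m_a}\mathrm{E}_{\theta_0}\left[\log\left\{\frac{p_\theta(y_{a,j})}{p_{\theta_0}(y_{a,j})}\right\}\right]<0;$$ (B3) there are positive constant sequences $s_N$, $s_{a,N}$, $1\le a\le b$, such that $$\sup_{\theta\in\Theta,\ |\theta-\theta_0|\le M}\ \max_{1\le c\le d}\left|\frac{\partial}{\partial\theta_c}\log\{p_\theta(y)\}\right|=O_{\mathrm{P}}(s_N)\quad\text{with}\quad \frac{\log(s_N)}{\min_{1\le a\le b}m_a}\to 0,$$ and, for each $1\le a\le b$, $$\sup_{\theta\in\Theta,\ |\theta-\theta_0|\le M}\ \frac{1}{m_a}\sum_{j=1}^{m_a}\max_{1\le c\le d}\left|\frac{\partial}{\partial\theta_c}\log\{p_\theta(y_{a,j})\}\right|=o_{\mathrm{P}}(s_{a,N})\quad\text{with}\quad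 \frac{\log(s_{a,N})}{m_a}\to 0,$$ and (for the same $s_{a,N}$) $$\sup_{\theta\in\Theta,\ |\theta-\theta_0|\le M}\ \frac{s_{a,N}^{d}}{m_a^2}\sum_{j=1}^{m_a}\mathrm{var}_{\theta_0}\left[\log\left\{\frac{p_\theta(y_{a,j})}{p_{\theta_0}(y_{a,j})}\right\}\right]\longrightarrow 0,\qquad 1\le a\le b.$$ In addition, suppose that the following (C1) and (C2) hold: (C1) There are sequences of constants $b_k,c_N\ge 1$ and random variables $\zeta_N$, where $c_N,\zeta_N$ do not depend on $k$, such that $\zeta_N=O_{\mathrm{P}}(1)$ and $$\sup_{\theta\in\Theta\cap S_d[k-1,k+2)}\ \max_{1\le c\le d}\left|\frac{\partial}{\partial\theta_c}\log\{p_\theta(y)\}\right|\le b_kc_N\zeta_N,\qquad k=1,2,\dots.$$ (C2) There is a subset of independent data vectors $y_{(j)}$, $1\le j\le m_N$ (not necessarily among those in (A1)), such that: (i) $\mathrm{E}_{\theta_0}|\log\{p_{j,\theta_0}(y_{(j)})\}|$ is bounded, $p_{j,\theta}(\cdot)$ being the probability mass function of $y_{(j)}$ under $\theta$; (ii) there is a sequence of positive constants $\gamma_k$ with $\lim_{k\to\infty}\gamma_k=\infty$, and a subset $\mathcal{T}_N$ of possible values of $y_{(j)}$, such that for every $k\ge 1$ and $\theta\in\Theta\cap S_d(k)$ there is $t\in\mathcal{T}_N$ satisfying $\max_{1\le j\le m_N}\log\{p_{j,\theta}(t)\}\le-\gamma_k$; (iii) $\inf_{t\in\mathcal{T}_N}m_N^{-1}\sum_{j=1}^{m_N}p_{j,\theta_0}(t)\ge\rho$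 for some constant $\rho>0$; (iv) $|\mathcal{T}_N|/m_N=o(1)$, and $$c_N^d\sum_{k=K}^\infty k^{d_1}b_k^de^{-\delta m_N\gamma_k}=o(1)$$ for some $K\ge 1$ and $\delta<\rho$, where $d_1=d\,1_{(d>1)}$. Then the maximum likelihood estimator (MLE) of $\theta_0$ is consistent, i.e., it converges to $\theta_0$ in probability as $N\to\infty$.
   Context: Generalized linear mixed model (GLMM). (i) Given a vector $u$ of random effects, responses $y_1,\dots,y_N$ are conditionally independent with conditional density, with respect to a $\sigma$-finite measure $\nu$, given by the exponential family $$f_i(y_i\mid u)=\exp\left[a_i^{-1}(\phi)\{y_i\xi_i-b(\xi_i)\}+c_i(y_i,\phi)\right],$$ where $\phi$ is a dispersion parameter (known in some cases), and $b(\cdot),a_i(\cdot),c_i(\cdot,\cdot)$ are known functions, continuously differentiable with respect to $\xi_i$ and $\phi$; the natural parameter $\xi_i$ is associated with the conditional mean $\mu_i=\mathrm{E}(y_i\mid u)$ according to the properties of the exponential family. (ii) $g(\mu_i)=x_i'\beta+z_i'u$, where $x_i,z_i$ are known vectors, $\beta$ is a vector of unknown parameters and $g(\cdot)$ is a link function. (iii) $u\sim N(0,G)$, where the covariance matrix $G$ may depend on a vector $\varphi$ of dispersion parameters. The vector of all unknown parameters is $\theta$, with parameter space $\Theta$ and true value $\theta_0$. The responses are discrete, so densities are probability mass functions. The model (including the random effects and the known vectors) may vary with $N$, and asymptotics are as $N\to\infty$ with $\Theta$ and $\theta_0$ fixed. Subsets of the data. Let $b$ be a fixed positive integer (not the function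 $b(\cdot)$ nor the constants $b_k$). For $1\le a\le b$, let $y_i^{(a)}$, $i=1,\dots,N_a$, be the $a$th subset of the data, and suppose there is a partition $\{1,\dots,N_a\}=\bigcup_{j=1}^{m_a}S_{a,j}$. Put $y_{a,j}=[y_i^{(a)}]_{i\in S_{a,j}}$. (The subsets, $N_a$, $m_a$ and the partitions may depend on $N$.) Let $p_\theta(y_{a,j})$ denote the (marginal) probability mass function of $y_{a,j}$ when $\theta$ is the true parameter vector. Likewise $p_\theta(y)$ is that of the full data $y=(y_i)_{1\le i\le N}$ under $\theta$. The independence in (A1) and (C2) is under every $\theta\in\Theta$. $\mathrm{P}_\theta,\mathrm{E}_\theta,\mathrm{var}_\theta$ denote probability, expectation and variance when $\theta$ is the true parameter vector. $O_{\mathrm{P}}$, $o_{\mathrm{P}}$ and convergence in probability are under $\mathrm{P}_{\theta_0}$ as $N\to\infty$; $o(1)$ is as $N\to\infty$. It is implicit in (B3) and (C1) that the partial derivatives appearing there exist. Notation: $|\cdot|$ is the Euclidean norm on $\mathbb{R}^d$ (and cardinality for the set $\mathcal{T}_N$); for $0\le v<w$, $S_d[v,w)=\{x\in\mathbb{R}^d: v\le|x|<w\}$, and $S_d(k)=S_d[k,k+1)$ for $k=1,2,\dots$; $1_{(d>1)}$ is $1$ if $d>1$ and $0$ otherwise; the supremum over an empty set in (B2) is $-\infty$. The constants $b_k,\gamma_k,\rho,\delta,K$ do not depend on $N$, and the bound in (C2)(i) is uniform in $j$ and $N$. The MLE is the (global) maximizer over $\Theta$ of the full-data likelihood $\theta\mapsto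 p_\theta(y)$; on data for which no global maximizer exists its value is arbitrary.
   Formalization: In (B3) the sequences s_{a,N} are assumed bounded away from 0 (the claim fails if they may tend to 0), and existence of the partial derivatives on Θ is taken to include continuity of the log-likelihoods, relative to Θ, at points of Θ on its boundary. *)

(* Defs.v *)
From HB Require Import structures.
From mathcomp Require Import all_boot all_order all_algebra finmap.
From mathcomp Require Import all_classical all_reals all_analysis.

Set Implicit Arguments.
Unset Strict Implicit.
Unset Printing Implicit Defensive.

Import Order.TTheory GRing.Theory Num.Theory.
Import numFieldNormedType.Exports.

Local Open Scope classical_set_scope.
Local Open Scope ring_scope.

Section Euclid.
Context {R : realType} {d : nat}.
Implicit Types x y : 'rV[R]_d.

Definition dot x y : R := \sum_(k < d) x 0 k * y 0 k.

(* The canonical norm on ['rV[R]_d] is the sup norm (same topology). *)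
Definition enorm x : R := Num.sqrt (dot x x).

Definition shell (v w : R) : set 'rV[R]_d := [set x | v <= enorm x < w].

End Euclid.

Section Partial.
Context {R : realType} {d : nat}.
Variable Theta : set 'rV[R]_d.
Implicit Types (f : 'rV[R]_d -> R) (theta : 'rV[R]_d) (c : 'I_d).

(* [f] is only meaningful on the convex set [Theta], so its partial derivatives
   are limits of difference quotients with increments staying in [Theta]:
   two-sided in the interior, possibly one-sided on the boundary.  At a boundary
   point from which [Theta] does not extend parallel to axis [c] the quotient is
   never defined, and [partial] is set to 0. *)
Definition extends theta c : Prop :=
  exists2 h : R, h != 0 & Theta (theta + h *: delta_mx 0 c).

Definition quotient f theta c (h : R) : R :=
  h^-1 * (f (theta + h *: delta_mx 0 c) - f theta).

Definition steps theta c : set_system R :=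
  within [set h | Theta (theta + h *: delta_mx 0 c)] 0^'.

Definition partial f theta c : R :=
  if `[< extends theta c >] then lim (quotient f theta c @ steps theta c) else 0.

(* Partial derivatives do not determine how [f] behaves at a boundary point
   relative to the interior (there may be no axis-parallel increment at all), so
   that existence is taken to include continuity relative to [Theta] at the
   points of [Theta] on its boundary.  Nothing is added when [Theta] is open. *)
Definition has_partials f : Prop :=
  (forall theta c, Theta theta -> extends theta c ->
     cvg (quotient f theta c @ steps theta c)) /\
  (forall theta, Theta theta -> ~ (interior Theta) theta ->
     f @ within Theta (nbhs theta) --> f theta).

Definition max_partial f theta : R :=
  \big[Num.max/0]_(c < d) `|partial f theta c|.

End Partial.

Section Laws.
Context {R : realType} {disp : measure_display} {T : measurableType disp}.
Implicit Type P : probability T R.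

Definition sigma_rv (I : Type) (X : I -> T -> R) : set_system T :=
  <<s [set A | exists i, exists2 B, measurable B & A = X i @^-1` B] >>.

Definition independent P (m : nat) (F : 'I_m -> set_system T) : Prop :=
  forall A : 'I_m -> set T, (forall j, F j (A j)) ->
    P (\bigcap_j A j) = (\prod_(j < m) fine (P (A j)))%:E.

Definition subvector (N : nat) (y : 'I_N -> T -> R) (I : finType)
    (J : I -> 'I_N) (w : T) : {ffun I -> R} := [ffun i => y (J i) w].

(* Joint counterpart of [pmf]. *)
Definition vpmf P (I : finType) (V : T -> {ffun I -> R}) (t : {ffun I -> R}) : R :=
  fine (P (V @^-1` [set t])).

(* [normal_prob 0 0] is not the Dirac measure at 0. *)
Definition centered_normal (v : R) (B : set R) : \bar R :=
  if v == 0 then \d_(0 : R) B else normal_prob 0 (Num.sqrt v) B.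

(* u ~ N(0, G), G possibly singular: all linear combinations are normal. *)
Definition mvnormal P (r : nat) (u : 'I_r -> T -> R) (G : 'M[R]_r) : Prop :=
  G^T = G /\
  forall s : 'rV[R]_r,
    let v := (s *m G *m s^T) 0 0 in
    0 <= v /\
    forall B : set R, measurable B ->
      P ((fun w => \sum_(k < r) s 0 k * u k w) @^-1` B) = centered_normal v B.

End Laws.

Definition continuously_differentiable {R : realType} (U : set R) (f : R -> R) :=
  forall t, U t -> derivable f t 1 /\ {for t, continuous (derive1 f)}.

(* The vector of unknown parameters is theta = (beta, phi, varphi), with beta of
   size p, varphi of size q, and phi present iff [e] holds. *)
Section Unknowns.
Context {R : realType} {p q : nat} {e : bool}.
Implicit Type theta : 'rV[R]_(p + (e + q)).

Definition par_beta theta : 'rV[R]_p := lsubmx theta.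

Definition par_phi (phi0 : R) theta : R :=
  (if e as e' return 'rV[R]_(nat_of_bool e') -> R
   then fun v => v 0 0 else fun=> phi0) (lsubmx (rsubmx theta)).

Definition par_varphi theta : 'rV[R]_q := rsubmx (rsubmx theta).

End Unknowns.

Record glmm (R : realType) (p q : nat) (e : bool) (N : nat) := Glmm {
  display : measure_display;
  Omega : measurableType display;
  Pr : 'rV[R]_(p + (e + q)) -> probability Omega R;
  resp : 'I_N -> {mfun Omega >-> R};
  nre : nat;
  reff : 'I_nre -> {mfun Omega >-> R};
  cov_x : 'I_N -> 'rV[R]_p;
  cov_z : 'I_N -> 'rV[R]_nre;
  values : set R;
  phi_known : R;
  fun_b : R -> R;
  fun_a : 'I_N -> R -> R;
  fun_c : 'I_N -> R -> R -> R;
  link : R -> R;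
  (* natural parameter as a function of the linear predictor *)
  natpar : R -> R;
  dom_xi : set R;
  dom_phi : set R;
  covmx : 'rV[R]_q -> 'M[R]_nre }.

Arguments resp {R p q e N} g _.
Arguments reff {R p q e N} g _.

Section Glmm.
Context {R : realType} {p q : nat} {e : bool} {N : nat}.
Variables (Theta : set 'rV[R]_(p + (e + q))) (M : glmm R p q e N).
Implicit Type theta : 'rV[R]_(p + (e + q)).

Definition data : Omega M -> {ffun 'I_N -> R} := subvector (resp M) id.

Definition expfam (i : 'I_N) (phi xi t : R) : R :=
  expR ((fun_a M i phi)^-1 * (t * xi - fun_b M xi) + fun_c M i t phi).

Definition eta (i : 'I_N) theta (v : 'rV[R]_(nre M)) : R :=
  dot (cov_x M i) (par_beta theta) + dot (cov_z M i) v.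

Definition cond_pmf (i : 'I_N) theta (v : 'rV[R]_(nre M)) (t : R) : R :=
  expfam i (par_phi (phi_known M) theta) (natpar M (eta i theta v)) t.

(* E(y_i | u = v) *)
Definition cond_mean (i : 'I_N) theta (v : 'rV[R]_(nre M)) : R :=
  \int[counting]_(t in values M) (t * cond_pmf i theta v t).

Definition reffv (w : Omega M) : 'rV[R]_(nre M) := \row_k reff M k w.

(* The dominating measure nu is the counting measure on the countable set
   [values M].  That the conditional mean is the derivative of [fun_b] at the
   natural parameter follows from the normalization on the open set [dom_xi]. *)
Record is_glmm : Prop := IsGlmm {
  glmm_countable : countable (values M);
  glmm_values : forall i w, values M (resp M i w);
  glmm_dom_xi : open (dom_xi M);
  glmm_dom_phi : open (dom_phi M);
  glmm_phi : forall theta, Theta theta ->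
    dom_phi M (par_phi (phi_known M) theta);
  glmm_b : continuously_differentiable (dom_xi M) (fun_b M);
  glmm_a : forall i, continuously_differentiable (dom_phi M) (fun_a M i) /\
    (forall phi, dom_phi M phi -> fun_a M i phi != 0);
  glmm_c : forall i t, values M t ->
    continuously_differentiable (dom_phi M) (fun_c M i t);
  glmm_expfam : forall i theta xi, Theta theta -> dom_xi M xi ->
    (\int[counting]_(t in values M)
       (expfam i (par_phi (phi_known M) theta) xi t)%:E = 1)%E;
  glmm_natpar : measurable_fun [set: R] (natpar M);
  glmm_link : forall i theta v, Theta theta ->
    dom_xi M (natpar M (eta i theta v)) /\
    link M (cond_mean i theta v) = eta i theta v;
  glmm_reff : forall theta, Theta theta ->
    mvnormal (Pr M theta) (reff M) (covmx M (par_varphi theta));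
  (* given u, the y_i are independent with densities [cond_pmf i theta u] *)
  glmm_cond : forall theta (A : set (Omega M)) (t : {ffun 'I_N -> R}),
    Theta theta -> sigma_rv (reff M) A -> (forall i, values M (t i)) ->
    (Pr M theta (A `&` data @^-1` [set t]) =
     \int[Pr M theta]_(w in A)
        (\prod_(i < N) cond_pmf i theta (reffv w) (t i))%:E)%E }.

Definition lik theta (I : finType) (J : I -> 'I_N) (w : Omega M) : R :=
  let V := subvector (resp M) J in vpmf (Pr M theta) V (V w).

Definition logratio theta theta0 (I : finType) (J : I -> 'I_N) (w : Omega M) : R :=
  ln (lik theta J w / lik theta0 J w).

Definition is_maximizer (v : {ffun 'I_N -> R}) theta : Prop :=
  Theta theta /\
  forall theta', Theta theta' ->
    vpmf (Pr M theta') data v <= vpmf (Pr M theta) data v.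

(* [est] is arbitrary on data for which there is no maximizer. *)
Definition is_mle (est : {ffun 'I_N -> R} -> 'rV[R]_(p + (e + q))) : Prop :=
  forall v, (exists theta, is_maximizer v theta) -> is_maximizer v (est v).

End Glmm.

Record subset_clusters (N : nat) := SubsetClusters {
  sub_size : nat;
  sub_idx : 'I_sub_size -> 'I_N;
  nclus : nat;
  clus : 'I_nclus -> {set 'I_sub_size};
  sub_idx_inj : injective sub_idx;
  clus_inj : injective clus;
  clus_partition : finset.partition [set clus j | j : 'I_nclus]%SET [set: 'I_sub_size]%SET }.

(* positions in the data of the components of the vector y_{a,j} *)
Definition clus_idx (N : nat) (S : subset_clusters N) (j : 'I_(nclus S))
    (i : {i : 'I_(sub_size S) | i \in clus j}) : 'I_N := sub_idx (val i).

Section Conditions.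
Context {R : realType} {p q : nat} {e : bool} {nb : nat}.
Local Notation d := (p + (e + q))%N.
Variables (M : forall N, glmm R p q e N).
Variables (Theta : set 'rV[R]_d) (theta0 : 'rV[R]_d).
(* subsets are indexed by 'I_nb.+1: the number of subsets is nb.+1 *)
Variable S : forall N, 'I_nb.+1 -> subset_clusters N.
Implicit Type theta : 'rV[R]_d.

Definition P0 N := Pr (M N) theta0.

Definition bounded_in_prob (X : forall N, Omega (M N) -> \bar R) (s : nat -> R) :=
  forall eps : R, 0 < eps -> exists2 C : R, 0 < C &
    \forall N \near \oo,
      (P0 N [set w | (C * s N)%:E < `|X N w|] <= eps%:E)%E.

Definition negligible_in_prob (X : forall N, Omega (M N) -> \bar R) (s : nat -> R) :=
  forall eps : R, 0 < eps ->
    (fun N => P0 N [set w | ((eps * s N)%:E < `|X N w|)%E]) @ \oo --> 0%E.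

Definition nearby (r : R) : set 'rV[R]_d :=
  [set theta | Theta theta /\ enorm (theta - theta0) <= r].

Definition full_loglik N (w : Omega (M N)) theta : R := ln (lik theta id w).

Definition clus_loglik N a j (w : Omega (M N)) theta : R :=
  ln (lik theta (@clus_idx N (S N a) j) w).

Definition min_nclus N : nat :=
  \big[minn/nclus (S N ord0)]_(a < nb.+1) nclus (S N a).

Definition A1 : Prop := forall a,
  (\forall N \near \oo, forall theta, Theta theta ->
     independent (Pr (M N) theta)
       (fun j => sigma_rv (fun i => resp (M N) (@clus_idx N (S N a) j i)))) /\
  (fun N => nclus (S N a)) @ \oo --> \oo.

Definition mean_logratio N theta a : \bar R :=
  ((nclus (S N a))%:R^-1%:E *
   \sum_(j < nclus (S N a))
      'E_(P0 N)[logratio (M := M N) theta theta0 (@clus_idx N (S N a) j)])%E.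

Definition B2 (r : R) : Prop :=
  (interior Theta) theta0 /\
  forall eps : R, 0 < eps ->
    (limn_esup (fun N => ereal_sup
       [set \big[Order.min/mean_logratio N theta ord0]_(a < nb.+1)
              mean_logratio N theta a |
        theta in nearby r `&` [set theta | (eps <= enorm (theta - theta0))%R]])
     < 0)%E.

(* "Positive" for the s_{a,N} is read as bounded away from 0: s_{a,N}^d stands
   for the number of points of a net of mesh 1/s_{a,N}, and if s_{a,N} may tend
   to 0 then consistency can fail.  (For s_N positivity suffices: max(s_N, 1)
   satisfies the same conditions.) *)
Definition B3 (r : R) : Prop :=
  exists (s : nat -> R) (sa : 'I_nb.+1 -> nat -> R),
  [/\ (forall N, 0 < s N) /\
      (exists2 kappa : R, 0 < kappa & forall a N, kappa <= sa a N),
      (\forall N \near \oo, forall w : Omega (M N),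
         has_partials Theta (full_loglik w) /\
         forall a j, has_partials Theta (clus_loglik (a := a) j w)),
      bounded_in_prob (fun N w => ereal_sup
        [set (max_partial Theta (full_loglik w) theta)%:E | theta in nearby r]) s /\
      (fun N => ln (s N) / (min_nclus N)%:R) @ \oo --> (0 : R),
      (forall a,
         negligible_in_prob (fun N w => ereal_sup
           [set ((nclus (S N a))%:R^-1 *
                 \sum_(j < nclus (S N a))
                   max_partial Theta (clus_loglik j w) theta)%:E |
            theta in nearby r]) (sa a) /\
         (fun N => ln (sa a N) / (nclus (S N a))%:R) @ \oo --> (0 : R)) &
      forall a,
        (fun N => ereal_sup
           [set ((sa a N ^+ d / (nclus (S N a))%:R ^+ 2)%:E *
                 \sum_(j < nclus (S N a))
                   'V_(P0 N)[logratio (M := M N) theta theta0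
                               (@clus_idx N (S N a) j)])%E |
            theta in nearby r]) @ \oo --> 0%E].

Definition C1 (bk cN : nat -> R) : Prop :=
  exists zeta : forall N, {mfun Omega (M N) >-> R},
  [/\ (forall k, 1 <= bk k) /\ (forall N, 1 <= cN N),
      bounded_in_prob (fun N w => (zeta N w)%:E) (fun=> 1),
      (\forall N \near \oo, forall w : Omega (M N),
         has_partials Theta (full_loglik w)) &
      \forall N \near \oo, {ae P0 N, forall w, forall k, (1 <= k)%N ->
        (ereal_sup [set (max_partial Theta (full_loglik w) theta)%:E |
           theta in Theta `&` shell (k%:R - 1) (k%:R + 2)] <=
         (bk k * cN N * zeta N w)%:E)%E}].

(* The vectors y_(j) have a common length [len N], so that a value t is a possible
   value of each of them. *)
Definition C2 (bk cN : nat -> R) : Prop :=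
  exists (m len : nat -> nat) (J : forall N, 'I_(m N) -> 'I_(len N) -> 'I_N)
    (T : forall N, {fset {ffun 'I_(len N) -> R}}) (gamma : nat -> R) (rho delta : R)
    (K : nat) (B : R),
  let pj N theta j := vpmf (Pr (M N) theta) (subvector (resp (M N)) (J N j)) in
  [/\ \forall N \near \oo,
        (forall j, injective (J N j)) /\
        (forall theta, Theta theta -> independent (Pr (M N) theta)
           (fun j => sigma_rv (fun i => resp (M N) (J N j i)))),
      \forall N \near \oo, forall j,
        ('E_(P0 N)[fun w => `|ln (lik (M := M N) theta0 (J N j) w)|%R] <= B%:E)%E,
      [/\ forall k, (1 <= k)%N -> 0 < gamma k,
          gamma @ \oo --> +oo,
          \forall N \near \oo, forall t, t \in T N -> forall i, values (M N) (t i) &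
          \forall N \near \oo, forall k theta, (1 <= k)%N -> Theta theta ->
            shell k%:R (k%:R + 1) theta ->
            exists2 t, t \in T N & forall j, ln (pj N theta j t) <= - gamma k],
      0 < rho /\
      (\forall N \near \oo, forall t, t \in T N ->
         rho <= (m N)%:R^-1 * \sum_(j < m N) pj N theta0 j t) &
      [/\ (fun N => (#|` T N|)%:R / (m N)%:R) @ \oo --> (0 : R),
          (1 <= K)%N, delta < rho &
          (fun N => ((cN N ^+ d)%:E *
             \sum_(K <= k <oo)
               (k%:R ^+ (d * (1 < d)%N) * bk k ^+ d *
                expR (- delta * (m N)%:R * gamma k))%:E)%E) @ \oo --> 0%E]].

Definition consistent (est : forall N, {ffun 'I_N -> R} -> 'rV[R]_d) : Prop :=
  forall eps : R, 0 < eps ->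
    (fun N => P0 N [set w | eps < enorm (est N (data w) - theta0)]) @ \oo --> 0%E.

End Conditions.

(* Main.v *)
Require Import Defs.
From mathcomp Require Import all_boot all_order all_algebra.
From mathcomp Require Import all_classical all_reals all_analysis.
From mathcomp Require Import measurable_realfun.
From mathcomp Require finmap.
From mathcomp Require Import ring lra.

Set Implicit Arguments.
Unset Strict Implicit.
Unset Printing Implicit Defensive.

Import Order.TTheory GRing.Theory Num.Theory.
Import numFieldNormedType.Exports.

Local Open Scope classical_set_scope.
Local Open Scope ring_scope.

(** Why the maximum likelihood estimator is consistent.

    Everything rests on the subset argument ([subset_argument]).  Given a part
    y1 of the data, the expectation under theta0 of the full likelihood ratio
    p_theta(y) / p_theta0(y) is the likelihood ratio of y1.  If y1 consists of m
    independent clusters, the latter ratio is a product over the clusters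
    ([lik_subset_argument]), typically of size exp(- lam m) for some lam > 0.
    By Markov's inequality a single theta then beats theta0 on the full data with
    exponentially small probability, although the full likelihood itself is
    intractable because of the random effects.

    To treat all theta at once, each region of the parameter space is covered by
    a finite net ([box_net], [shell_net]) that is fine enough for the bound on
    the gradient of the full log-likelihood to make it vary by O(1) between a
    parameter and the nearest net point.  If some theta of the region beats
    theta0, then a net point nearly does, and the number of net points is small
    compared with the exponential.  Two points need care: bounded partial
    derivatives yield a Lipschitz bound up to the boundary of the convex set
    Theta ([convex_lipschitz]), and logarithms are meaningful because every
    possible value of the data has positive probability under every parameter
    ([lik_gt0]).

    At a bounded distance from theta0 ([annulus_likely]) the smallness of the
    cluster ratios comes from a law of large numbers ([cluster_lln]): each theta
    has a subset of the data whose mean log-ratio is at most - lam, and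
    Chebyshev's inequality on a second net, whose mesh is dictated by the
    gradients of that subset, shows that the sample mean is at most - lam / 2
    for all these theta simultaneously.  The net for the full likelihood has
    about s^d points, where log s is negligible against the number of clusters.

    Far from the origin ([shells_likely]) no expansion around theta0 is
    available.  Instead, a theta in the k-th shell makes some value t
    exponentially unlikely, while under theta0 a positive proportion of the
    clusters equals t ([frequency_likely]); so theta explains the clusters
    exponentially worse than theta0 ([far_logratio]).  The shells are covered by
    nets whose sizes, weighted by the exponential bounds, form a small series.

    With probability tending to one, therefore, theta0 beats every parameter
    outside a small ball around it.  The maximum of the likelihood over a small
    closed box, which exists by compactness, is then a global maximum
    ([maximizer_exists]); so the estimator is a maximizer, and it lies in the
    ball. *)

(** * Euclidean and sup norms on row vectors, convex sets *)

Section Geometry.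
Context {R : realType} {d : nat}.
Implicit Types x y z : 'rV[R]_d.

Lemma dot_ge0 x : 0 <= dot x x.
Proof. by apply: sumr_ge0 => i _; rewrite -expr2 sqr_ge0. Qed.

Lemma dot_lin x y (a b : R) :
  dot (a *: x + b *: y) (a *: x + b *: y) =
  a ^+ 2 * dot x x + 2 * a * b * dot x y + b ^+ 2 * dot y y.
Proof.
rewrite /dot !mulr_sumr -!big_split /=; apply: eq_bigr => i _.
by rewrite !mxE; ring.
Qed.

Lemma dot_CauchySchwarz x y : dot x y ^+ 2 <= dot x x * dot y y.
Proof.
have X0 := dot_ge0 x; have Y0 := dot_ge0 y.
have h a b := dot_ge0 (a *: x + b *: y).
have {}h a b : 0 <= a ^+ 2 * dot x x + 2 * a * b * dot x y + b ^+ 2 * dot y y.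
  by rewrite -dot_lin.
move: (dot x y) (dot x x) (dot y y) X0 Y0 h => Z X Y X0 Y0 h.
have [Y1|Y1] := eqVneq Y 0; last first.
  have {}Y0 : 0 < Y by rewrite lt_def Y1.
  have := h Y (- Z).
  rewrite (_ : _ + _ = Y * (X * Y - Z ^+ 2)); last by ring.
  by rewrite pmulr_rge0// subr_ge0.
have [X1|X1] := eqVneq X 0; last first.
  have {}X0 : 0 < X by rewrite lt_def X1.
  have := h (- Z) X.
  rewrite (_ : _ + _ = X * (X * Y - Z ^+ 2)); last by ring.
  by rewrite pmulr_rge0// subr_ge0.
by have := h 1 (- Z); rewrite X1 Y1; nra.
Qed.

Lemma enorm_ge0 x : 0 <= enorm x. Proof. exact: sqrtr_ge0. Qed.

Lemma enorm_sqr x : enorm x ^+ 2 = dot x x.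
Proof. by rewrite sqr_sqrtr// dot_ge0. Qed.

Lemma enormD x y : enorm (x + y) <= enorm x + enorm y.
Proof.
rewrite -(@ler_pXn2r _ 2)// ?nnegrE ?addr_ge0 ?enorm_ge0//.
have := dot_lin x y 1 1; rewrite !scale1r enorm_sqr => ->.
rewrite sqrrD !enorm_sqr !expr1n !mul1r mulr1.
have : dot x y <= enorm x * enorm y.
  rewrite (le_trans (ler_norm _))//.
  rewrite -(@ler_pXn2r _ 2)// ?nnegrE ?mulr_ge0 ?enorm_ge0//.
  by rewrite real_normK ?num_real// exprMn !enorm_sqr dot_CauchySchwarz.
by rewrite -mulr_natl; lra.
Qed.

Lemma enormN x : enorm (- x) = enorm x.
Proof.
by rewrite /enorm /dot; congr Num.sqrt; apply: eq_bigr => i _; rewrite !mxE mulrNN.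
Qed.

Lemma enormB x y : enorm x <= enorm y + enorm (x - y).
Proof. by rewrite -{1}(subrK y x) addrC enormD. Qed.

Lemma coord_le_norm x i : `|x 0 i| <= `|x|.
Proof.
rewrite [leRHS]mx_normrE.
exact: (@le_bigmax _ _ _ 0 (fun ij : 'I_1 * 'I_d => `|x ij.1 ij.2|) (0, i)).
Qed.

Lemma norm_leP x (e : R) : 0 <= e -> (forall i, `|x 0 i| <= e) -> `|x| <= e.
Proof.
move=> e0 h; rewrite [leLHS]mx_normrE; apply/bigmax_leP; split=> // -[i j] _ /=.
by rewrite (ord1 i).
Qed.

Lemma norm_le_enorm x : `|x| <= enorm x.
Proof.
apply: norm_leP => [|i]; first exact: enorm_ge0.
rewrite -(@ler_pXn2r _ 2)// ?nnegrE ?enorm_ge0// enorm_sqr real_normK ?num_real//.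
rewrite /dot (bigD1 i)//= -expr2 lerDl.
by apply: sumr_ge0 => j _; rewrite -expr2 sqr_ge0.
Qed.

Lemma enorm_le_norm x : enorm x <= d%:R * `|x|.
Proof.
rewrite -(@ler_pXn2r _ 2)// ?nnegrE ?enorm_ge0 ?mulr_ge0// enorm_sqr.
have : dot x x <= d%:R * `|x| ^+ 2.
  apply: (@le_trans _ _ (\sum_(i < d) `|x| ^+ 2)).
    apply: ler_sum => i _; rewrite -expr2 -real_normK ?num_real//.
    by rewrite ler_pXn2r// ?nnegrE// coord_le_norm.
  by rewrite sumr_const card_ord mulr_natl.
move=> /le_trans; apply; rewrite exprMn ler_wpM2r ?sqr_ge0//.
by rewrite -natrX ler_nat; case: d => // n; rewrite leq_pmulr.
Qed.

End Geometry.

Section Convexity.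
Context {R : realType} {d : nat}.
Implicit Types x y z : 'rV[R]_d.
Variable Theta : set 'rV[R]_d.

Lemma convex_setP x y (t : R) : convex_set Theta -> Theta x -> Theta y ->
  0 <= t <= 1 -> Theta (x + t *: (y - x)).
Proof.
move=> cT Tx Ty t01.
pose k := Itv01 (andP t01).1 (andP t01).2.
have := cT y x k (mem_set Ty) (mem_set Tx); rewrite inE.
rewrite /conv/=; congr (Theta _); apply/rowP => i; rewrite !mxE.
by rewrite /unstable.onem; ring.
Qed.

Lemma interior_ball x : interior Theta x <->
  exists2 e : R, 0 < e & forall y, `|x - y| < e -> Theta y.
Proof.
rewrite /interior /=; split.
  move=> /nbhs_ballP[e /= e0 h]; exists e => // y xy; apply: h.
  by rewrite mx_norm_ball.
move=> [e e0 h]; apply/nbhs_ballP; exists e => // y.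
by rewrite mx_norm_ball => /h.
Qed.

(** The homothety of centre x and ratio t maps a ball around y into Theta. *)
Lemma interior_segment x y (t : R) : convex_set Theta -> Theta x ->
  interior Theta y -> 0 < t <= 1 -> interior Theta (x + t *: (y - x)).
Proof.
move=> cT Tx /interior_ball[e e0 h] /andP[t0 t1].
apply/interior_ball; exists (t * e); first by rewrite mulr_gt0.
move=> z xz.
pose y' := x + t^-1 *: (z - x).
have -> : z = x + t *: (y' - x).
  by apply/rowP => i; rewrite !mxE; field; rewrite gt_eqF.
apply: convex_setP => //; last by rewrite ltW.
apply: h; rewrite /y'.
have -> : y - (x + t^-1 *: (z - x)) = t^-1 *: (x + t *: (y - x) - z).
  by apply/rowP => i; rewrite !mxE; field; rewrite gt_eqF.
by rewrite normrZ gtr0_norm ?invr_gt0// mulrC ltr_pdivrMr// mulrC.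
Qed.

End Convexity.

(** * Lipschitz bounds from bounded partial derivatives *)

Section AxisLipschitz.
Context {R : realType} {d : nat}.
Implicit Types x y z : 'rV[R]_d.
Variable Theta : set 'rV[R]_d.
Variable f : 'rV[R]_d -> R.
Hypothesis pf : has_partials Theta f.

Lemma norm_axis (c : 'I_d) (h : R) : `|h *: (delta_mx 0 c : 'rV[R]_d)| <= `|h|.
Proof.
apply: norm_leP => // i; rewrite !mxE eqxx /=.
by case: (i == c) => /=; rewrite ?mulr1 ?mulr0 ?normr0.
Qed.

(** At an interior point all small increments stay in Theta, so that the limit along
    [steps] is the usual partial derivative. *)
Lemma interior_quotient_cvg x c : interior Theta x ->
  quotient f x c h @[h --> 0^'] --> partial Theta f x c.
Proof.
move=> Ix; have [e e0 xe] := (interior_ball Theta x).1 Ix.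
have Tx : Theta x by apply: xe; rewrite subrr normr0.
have near_Theta (h : R) : `|h| < e -> Theta (x + h *: delta_mx 0 c).
  move=> he; apply: xe; rewrite opprD addrA subrr sub0r normrN.
  exact: le_lt_trans (norm_axis c h) he.
have ex : extends Theta x c.
  exists (e / 2); first by rewrite gt_eqF// divr_gt0.
  by apply: near_Theta; rewrite gtr0_norm ?divr_gt0// ltr_pdivrMr// ltr_pMr// ltr1n.
have := pf.1 x c Tx ex; rewrite /partial asboolT//.
move=> h A /h; rewrite /steps !nbhs_filterE /= /within => hA.
have hD : \forall h \near (0:R)^', Theta (x + h *: delta_mx 0 c).
  near=> t; apply: near_Theta.
  by near: t; exact: dnbhs0_lt.
by apply: filterS2 hD hA => t Dt; apply.
Unshelve. all: by end_near.
Qed.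

Lemma interior_is_derive x c (t : R) : interior Theta (x + t *: delta_mx 0 c) ->
  is_derive t (1:R) (fun s : R => f (x + s *: delta_mx 0 c))
    (partial Theta f (x + t *: delta_mx 0 c) c).
Proof.
move=> Ix.
have E : (fun h : R => h^-1 *: ((fun s => f (x + s *: delta_mx 0 c)) (h *: 1 + t) -
    f (x + t *: delta_mx 0 c))) = quotient f (x + t *: delta_mx 0 c) c.
  apply/funext => s; rewrite /quotient /= -addrA -scalerDl.
  by rewrite /GRing.scale /= mulr1 [s + t]addrC.
have cv : derivable (fun s : R => f (x + s *: delta_mx 0 c)) t (1 : R).
  rewrite /derivable /= /shift/= E; apply/cvg_ex; exists (partial Theta f (x + t *: delta_mx 0 c) c).
  exact: interior_quotient_cvg.
split => //; rewrite /derive /= /shift/= E.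
by apply/cvg_lim => //; exact: interior_quotient_cvg.
Qed.

Lemma partial_le_max x c : `|partial Theta f x c| <= max_partial Theta f x.
Proof. exact: (le_bigmax _ (fun c => `|partial Theta f x c|) c). Qed.

Lemma axis_lipschitz x c (a b L : R) : a <= b ->
  (forall t, a <= t <= b -> interior Theta (x + t *: delta_mx 0 c) /\
     max_partial Theta f (x + t *: delta_mx 0 c) <= L) ->
  `|f (x + b *: delta_mx 0 c) - f (x + a *: delta_mx 0 c)| <= L * (b - a).
Proof.
move=> ab h; pose g (s : R) := f (x + s *: delta_mx 0 c).
pose dg_ t := partial Theta f (x + t *: delta_mx 0 c) c.
have dg (t : R) : t \in `[a, b]%R -> is_derive t (1 : R) g (dg_ t).
  by rewrite in_itv /= => /h[Ix _]; exact: interior_is_derive.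
have dg' t : t \in `]a, b[%R -> is_derive t (1 : R) g (dg_ t).
  by move=> tab; apply: dg; exact: subset_itv_oo_cc tab.
have cg : {within `[a, b], continuous g}.
  by apply: derivable_within_continuous => t /dg[].
have [u] := MVT_segment ab dg' cg.
rewrite in_itv /= => uab; rewrite /g /dg_ => ->.
rewrite normrM [`|b - a|]ger0_norm ?subr_ge0// ler_wpM2r ?subr_ge0//.
exact: le_trans (partial_le_max _ _) (h _ uab).2.
Qed.

End AxisLipschitz.

Section BoxLipschitz.
Context {R : realType} {d : nat}.
Implicit Types x y z : 'rV[R]_d.
Variable Theta : set 'rV[R]_d.
Variable f : 'rV[R]_d -> R.
Hypothesis pf : has_partials Theta f.

Lemma max_partial_ge0 x : 0 <= max_partial Theta f x.
Proof. exact: bigmax_ge_id. Qed.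

Lemma axis_lipschitz_abs x c (a b L : R) :
  (forall t, Num.min a b <= t <= Num.max a b ->
     interior Theta (x + t *: delta_mx 0 c) /\
     max_partial Theta f (x + t *: delta_mx 0 c) <= L) ->
  `|f (x + b *: delta_mx 0 c) - f (x + a *: delta_mx 0 c)| <= L * `|b - a|.
Proof.
have [ab|/ltW ab] := leP a b => h.
  by rewrite [`|b - a|]ger0_norm ?subr_ge0//; exact: (axis_lipschitz pf).
rewrite distrC (distrC b) (ger0_norm (x := a - b)) ?subr_ge0//.
exact: (axis_lipschitz pf).
Qed.

(** The coordinates are changed one at a time.  A ball of the sup norm is a box, so
    the intermediate points do not leave it; in a Euclidean ball they might. *)
Lemma box_lipschitz z (e L : R) :
  (forall w, `|z - w| < e -> interior Theta w /\ max_partial Theta f w <= L) ->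
  forall x y, `|z - x| < e -> `|z - y| < e -> `|f y - f x| <= L * d%:R * `|y - x|.
Proof.
move=> h x y zx zy.
have L0 : 0 <= L by apply: le_trans (h x zx).2; exact: max_partial_ge0.
(* p k has the first k coordinates of y and the others of x *)
pose p k : 'rV[R]_d := \row_i (if (i < k)%N then y 0 i else x 0 i).
have p0 : p 0%N = x by apply/rowP => i; rewrite !mxE.
have pd : p d = y by apply/rowP => i; rewrite !mxE ltn_ord.
rewrite -{1}pd -{1}p0 -(telescope_sumr (fun k => f (p k)))// big_mkord.
apply: (le_trans (ler_norm_sum _ _ _)).
apply: (@le_trans _ _ (\sum_(i < d) L * `|y - x|)); last first.
  by rewrite sumr_const card_ord mulrAC mulr_natr.
apply: ler_sum => k _.
pose w := p k - x 0 k *: delta_mx 0 k.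
have -> : p k.+1 = w + y 0 k *: delta_mx 0 k.
  apply/rowP => i; rewrite !mxE ltnS /=.
  have [->|ik] := eqVneq i k; first by rewrite leqnn ltnn ?eqxx /=; ring.
  rewrite leq_eqVlt val_eqE (negbTE ik) /=; case: ifP => _; ring.
have -> : p k = w + x 0 k *: delta_mx 0 k by rewrite /w subrK.
apply: le_trans (_ : L * `|y 0 k - x 0 k| <= _); last first.
  by rewrite ler_wpM2l// (le_trans _ (coord_le_norm _ k))// !mxE.
apply: axis_lipschitz_abs => t tab; apply: h.
apply: le_lt_trans (_ : Num.max `|z - x| `|z - y| < e); last by rewrite gt_max zx.
apply: norm_leP => [|i]; first by rewrite le_max normr_ge0.
have hx : `|z 0 i - x 0 i| <= `|z - x|.
  by rewrite (le_trans _ (coord_le_norm _ i))// !mxE.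
have hy : `|z 0 i - y 0 i| <= `|z - y|.
  by rewrite (le_trans _ (coord_le_norm _ i))// !mxE.
rewrite !mxE /= le_max; have [ik|ik] := eqVneq i k; last first.
  by case: ifP => _; rewrite mulr0 subr0 mulr0 addr0 ?hx ?hy ?orbT.
subst i; rewrite ltnn mulr1 subrr add0r mulr1.
move: tab hx hy; rewrite ge_min le_max.
move: (`|z - x|) (`|z - y|) => a b.
rewrite !ler_norml => /andP[/orP t1 /orP t2] /andP[x1 x2] /andP[y1 y2].
have [xt|xt] := leP (x 0 k) t.
- case: t2 => t2.
    by apply/orP; left; apply/andP; split; lra.
  have [zt|zt] := leP (z 0 k) t.
    by apply/orP; right; apply/andP; split; lra.
  by apply/orP; left; apply/andP; split; lra.
- case: t1 => t1; first by lra.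
  have [zt|zt] := leP (z 0 k) t.
    by apply/orP; left; apply/andP; split; lra.
  by apply/orP; right; apply/andP; split; lra.
Qed.

(** By continuation: the supremum of the t with |g t - g 0| <= K t satisfies this
    bound, and a supremum below 1 could be passed. *)
Lemma locally_lipschitz_segment (g : R -> R) (K : R) : 0 <= K ->
  (forall t, 0 <= t <= 1 -> exists2 e, 0 < e &
     forall s u, 0 <= s <= 1 -> 0 <= u <= 1 -> `|t - s| < e -> `|t - u| < e ->
       `|g s - g u| <= K * `|s - u|) ->
  `|g 1 - g 0| <= K.
Proof.
move=> K0 h.
pose A := [set t | 0 <= t <= 1 /\ `|g t - g 0| <= K * t].
have A0 : A 0 by rewrite /A /= lexx ler01 subrr normr0 mulr0.
have ubA : ubound A 1 by move=> t [/andP[]].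
have sA : has_sup A by split; [exists 0|exists 1].
have m0 : 0 <= sup A by apply: ub_le_sup => //; exists 1.
have m1 : sup A <= 1 by apply: ge_sup => //; exists 0.
have [e e0 he] := h (sup A) (introT andP (conj m0 m1)).
have [s As se] := sup_adherent e0 sA.
have sm : s <= sup A by apply: ub_le_sup => //; exists 1.
have step u : s <= u <= 1 -> u < sup A + e -> A u.
  move=> /andP[su u1] ue; move: As; rewrite /A /= => -[/andP[s0 s1] gs].
  have u0 := le_trans s0 su; rewrite u0 u1; split=> //.
  have gu : `|g u - g s| <= K * (u - s).
    rewrite -[u - s]ger0_norm ?subr_ge0//; apply: he; rewrite ?u0 ?s0//.
      by rewrite ltr_norml; apply/andP; split; lra.
    by rewrite ltr_norml; apply/andP; split; lra.
  rewrite (_ : g u - g 0 = (g u - g s) + (g s - g 0)); last by ring.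
  by rewrite (le_trans (ler_normD _ _))//; lra.
have Am : A (sup A) by apply: step; rewrite ?sm ?m1// ltrDl.
have [m1'|m1'] := ltP (sup A) 1; last first.
  have {}m1 : sup A = 1 by apply/eqP; rewrite eq_le m1.
  by move: Am; rewrite m1 /A /= mulr1 => -[].
pose u := Num.min 1 (sup A + e / 2).
have um : sup A < u by rewrite lt_min m1' ltrDl divr_gt0.
have : A u.
  apply: step; first by rewrite ge_min lexx andbT (le_trans sm (ltW um)).
  by rewrite gt_min ltrD2l ltr_pdivrMr// ltr_pMr// ltr1n orbT.
by move=> /(ub_le_sup (ex_intro _ 1 ubA)); rewrite leNgt um.
Qed.

End BoxLipschitz.

Section ConvexLipschitz.
Context {R : realType} {d : nat}.
Implicit Types x y z : 'rV[R]_d.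
Variable Theta : set 'rV[R]_d.
Variable f : 'rV[R]_d -> R.
Hypothesis cT : convex_set Theta.
Hypothesis pf : has_partials Theta f.
Variables (x0 : 'rV[R]_d) (h L : R).
Hypothesis bL : forall x, Theta x -> `|x0 - x| < h -> max_partial Theta f x <= L.

Lemma interior_ball_lipschitz x : interior Theta x -> `|x0 - x| < h ->
  exists2 e, 0 < e & forall y z, `|x - y| < e -> `|x - z| < e ->
    `|f z - f y| <= L * d%:R * `|z - y|.
Proof.
move=> /interior_ball[e1 e10 h1] xh.
pose e := Num.min e1 (h - `|x0 - x|).
exists e; first by rewrite lt_min e10 subr_gt0.
apply: (box_lipschitz pf) => w; rewrite lt_min => /andP[xw1 xw2]; split.
  apply/interior_ball; exists (e1 - `|x - w|); first by rewrite subr_gt0.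
  move=> y wy; apply: h1; rewrite (le_lt_trans (ler_distD w _ _))//.
  by rewrite -ltrBrDl.
apply: bL; first exact: h1.
by rewrite (le_lt_trans (ler_distD x _ _))// -ltrBrDl.
Qed.

(** An axis-parallel path between two points may leave Theta, so that
    [box_lipschitz] is only available near each point of the interior; the segment
    from x to y remains in the interior and spreads the bound. *)
Lemma interior_lipschitz x y : interior Theta x -> interior Theta y ->
  `|x0 - x| < h -> `|x0 - y| < h -> `|f y - f x| <= L * d%:R * `|y - x|.
Proof.
move=> Ix Iy xh yh.
pose g (t : R) := f (x + t *: (y - x)).
have -> : f y = g 1 by rewrite /g scale1r addrC subrK.
have -> : f x = g 0 by rewrite /g scale0r addr0.
have L0 : 0 <= L.
  exact: le_trans (max_partial_ge0 _ _ _) (bL (interior_subset Ix) xh).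
apply: locally_lipschitz_segment; first by rewrite !mulr_ge0.
move=> t /andP[t0 t1]; pose z := x + t *: (y - x).
have Iz : interior Theta z.
  rewrite /z; have [->|t0'] := eqVneq t 0; first by rewrite scale0r addr0.
  apply: interior_segment => //; first exact: interior_subset.
  by rewrite lt_def t0' t0.
have zh : `|x0 - z| < h.
  have -> : x0 - z = (1 - t) *: (x0 - x) + t *: (x0 - y).
    by apply/rowP => i; rewrite !mxE; ring.
  rewrite (le_lt_trans (ler_normD _ _))// !normrZ (ger0_norm t0) ger0_norm ?subr_ge0//.
  move: (`|x0 - x|) (`|x0 - y|) xh yh => a b ah bh.
  have [t1'|t1'] := ltP t 1; last by rewrite (_ : t = 1); [lra|lra].
  have : (1 - t) * a < (1 - t) * h by rewrite ltr_pM2l// subr_gt0.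
  have : t * b <= t * h by rewrite ler_wpM2l// ltW.
  by lra.
have [e e0 he] := interior_ball_lipschitz Iz zh.
have n0 : 0 < 1 + `|y - x| by rewrite ltr_pwDl.
exists (e / (1 + `|y - x|)); first by rewrite divr_gt0.
move=> s u _ _ ts tu.
have near r : `|t - r| < e / (1 + `|y - x|) -> `|z - (x + r *: (y - x))| < e.
  have -> : z - (x + r *: (y - x)) = (t - r) *: (y - x).
    by apply/rowP => i; rewrite !mxE; ring.
  rewrite normrZ ltr_pdivlMr// => /(le_lt_trans _); apply.
  by rewrite ler_wpM2l// lerDr.
apply: le_trans (he _ _ (near _ tu) (near _ ts)) _.
have -> : x + s *: (y - x) - (x + u *: (y - x)) = (s - u) *: (y - x).
  by apply/rowP => i; rewrite !mxE; ring.
by rewrite normrZ [X in _ * X]mulrC mulrA.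
Qed.

(** The local Lipschitz bound gives continuity in the interior; at the other points
    it is part of the existence of the partial derivatives. *)
Lemma within_continuous_at x : Theta x -> `|x0 - x| < h ->
  forall e, 0 < e -> exists2 r, 0 < r &
    forall y, Theta y -> `|x - y| < r -> `|f x - f y| < e.
Proof.
move=> Tx xh e e0; have [Ix|Ix] := pselect (interior Theta x).
  have [r r0 hr] := interior_ball_lipschitz Ix xh.
  have L0 : 0 <= L * d%:R by rewrite mulr_ge0// (le_trans _ (bL Tx xh))// max_partial_ge0.
  have k0 : 0 < L * d%:R + 1 by rewrite ltr_wpDl.
  exists (Num.min r (e / (L * d%:R + 1))); first by rewrite lt_min r0 divr_gt0.
  move=> y _; rewrite lt_min => /andP[xr]; rewrite ltr_pdivlMr// => xe.
  rewrite (le_lt_trans (hr _ _ xr _))//; first by rewrite subrr normr0.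
  by rewrite (le_lt_trans _ xe)// mulrC ler_wpM2l// lerDl.
have := pf.2 x Tx Ix => /cvgrPdist_lt /(_ e e0).
rewrite /within /= => /nbhs_ballP[r /= r0 hr]; exists r => // y Ty xy.
by apply: hr => //; rewrite mx_norm_ball.
Qed.

(** A boundary point of Theta need not admit any axis-parallel increment.  Both points
    are therefore moved slightly towards an interior point z; this shortens the
    distance between them, and continuity relative to Theta controls the effect of
    the move on f. *)
Lemma convex_lipschitz z x y : interior Theta z -> Theta x -> Theta y ->
  `|x0 - x| < h -> `|x0 - y| < h -> `|f y - f x| <= L * d%:R * `|y - x|.
Proof.
move=> Iz Tx Ty xh yh.
have L0 : 0 <= L * d%:R.
  by rewrite mulr_ge0// (le_trans _ (bL Tx xh))// max_partial_ge0.
apply/ler_addgt0Pr => e e0.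
have e2 : 0 < e / 2 by rewrite divr_gt0.
have [r r0 hr] := within_continuous_at Tx xh e2.
have [s s0 hs] := within_continuous_at Ty yh e2.
(* k exceeds both distances to z, so that a move of ratio t <= m / k is shorter than m *)
pose k := 1 + `|z - x| + `|z - y|.
have k0 : 0 < k by rewrite /k -addrA ltr_pwDl// addr_ge0.
pose m := Num.min (Num.min r s) (Num.min (h - `|x0 - x|) (h - `|x0 - y|)).
have m0 : 0 < m by rewrite !lt_min r0 s0 !subr_gt0 xh yh.
pose t := Num.min 1 (m / k).
have t01 : 0 < t <= 1 by rewrite lt_min ltr01 divr_gt0//= ge_min lexx.
have /andP[t0 t1] := t01.
have tk : t * k <= m by rewrite -ler_pdivlMr// ge_min lexx orbT.
have move_lt w : Theta w -> `|z - w| < k -> `|w - (w + t *: (z - w))| < m.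
  move=> Tw wk; rewrite opprD addrA subrr sub0r normrN normrZ gtr0_norm//.
  by rewrite (lt_le_trans _ tk)// ltr_pM2l.
have zx : `|z - x| < k by rewrite /k addrAC ltr_pwDl// ltr_pwDl.
have zy : `|z - y| < k by rewrite /k ltr_pwDl// ltr_pwDl.
have mx := move_lt x Tx zx; have my := move_lt y Ty zy.
set x' := x + t *: (z - x) in mx *; set y' := y + t *: (z - y) in my *.
have Ix : interior Theta x' by exact: interior_segment.
have Iy : interior Theta y' by exact: interior_segment.
have := mx; rewrite !lt_min => /andP[/andP[mxr _] /andP[mxh _]].
have := my; rewrite !lt_min => /andP[/andP[_ mys] /andP[_ myh]].
have xh' : `|x0 - x'| < h.
  by rewrite (le_lt_trans (ler_distD x _ _))// -ltrBrDl.
have yh' : `|x0 - y'| < h.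
  by rewrite (le_lt_trans (ler_distD y _ _))// -ltrBrDl.
have := interior_lipschitz Ix Iy xh' yh'.
have -> : y' - x' = (1 - t) *: (y - x).
  by apply/rowP => i; rewrite !mxE; ring.
rewrite normrZ (ger0_norm (x := 1 - t)) ?subr_ge0// => H1.
have {}H1 : `|f y' - f x'| <= L * d%:R * `|y - x|.
  rewrite (le_trans H1)// ler_wpM2l// ler_piMl//.
  by rewrite lerBlDr lerDl ltW.
have H2 := hr x' (interior_subset Ix) mxr.
have H3 := hs y' (interior_subset Iy) mys.
have -> : f y - f x = (f y - f y') + (f y' - f x') + - (f x - f x') by ring.
rewrite (le_trans (ler_normD _ _))// normrN.
rewrite (le_trans (lerD (ler_normD _ _) (lexx _)))//.
by lra.
Qed.

End ConvexLipschitz.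

Lemma cvg_sumr (R : realType) (T : Type) (F : set_system T) (m : nat)
    (f : 'I_m -> T -> R) (l : 'I_m -> R) : Filter F ->
  (forall j, f j @ F --> l j) -> (\sum_(j < m) f j x @[x --> F]) --> \sum_(j < m) l j.
Proof.
move=> FF fl; elim: (index_enum _) => [|a s ih].
  rewrite big_nil; under eq_fun do rewrite big_nil; exact: cvg_cst.
by rewrite big_cons; under eq_fun do rewrite big_cons; exact: cvgD.
Qed.

Section SumOfPartials.
Context {R : realType} {d : nat}.
Variable Theta : set 'rV[R]_d.
Hypothesis cT : convex_set Theta.

(** Convexity makes the admissible increments accumulate at 0 as soon as there is one,
    so that the limit defining a partial derivative is unique. *)
Lemma steps_proper theta c : Theta theta -> extends Theta theta c ->
  ProperFilter (steps Theta theta c).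
Proof.
move=> Tt [h h0 Th]; apply: Build_ProperFilter; rewrite /steps /within /= => hs.
have : \forall t \near 0^', ~ Theta (theta + t *: delta_mx 0 c).
  by apply: filterS hs => t; apply.
move=> /nbhs_ballP[e /= e0 he].
pose t := Num.min 1 (e / (2 * `|h|)).
have h0' : 0 < `|h| by rewrite normr_gt0.
have t0 : 0 < t by rewrite lt_min ltr01 divr_gt0// mulr_gt0.
apply: (he (t * h)).
- rewrite /ball /= sub0r normrN normrM gtr0_norm//.
  apply: (@le_lt_trans _ _ (e / 2)); last by rewrite ltr_pdivrMr// ltr_pMr// ltr1n.
  by rewrite -ler_pdivlMr// -mulrA -invfM ge_min lexx orbT.
- by rewrite mulf_neq0// gt_eqF.
- have := @convex_setP _ _ _ theta _ t cT Tt Th.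
  rewrite (_ : theta + t *: _ = theta + (t * h) *: delta_mx 0 c); last first.
    by rewrite addrAC subrr add0r scalerA.
  by apply; rewrite ltW//= ge_min lexx.
Qed.

Variables (m : nat) (f : 'I_m -> 'rV[R]_d -> R).
Hypothesis pf : forall j, has_partials Theta (f j).
Let F theta := \sum_(j < m) f j theta.

Lemma sum_quotient_cvg theta c : Theta theta -> extends Theta theta c ->
  quotient F theta c @ steps Theta theta c --> \sum_(j < m) partial Theta (f j) theta c.
Proof.
move=> Tt ex; have PF := steps_proper Tt ex.
rewrite (_ : quotient F theta c = fun h => \sum_(j < m) quotient (f j) theta c h); last first.
  by apply/funext => h; rewrite /quotient /F -sumrB mulr_sumr.
apply: cvg_sumr => j.
by have := (pf j).1 theta c Tt ex; rewrite /partial asboolT.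
Qed.

Lemma has_partials_sum : has_partials Theta F.
Proof.
split=> [theta c Tt ex|theta Tt nI].
  by apply/cvg_ex; eexists; exact: sum_quotient_cvg.
by apply: cvg_sumr => j; exact: (pf j).2.
Qed.

(** Partial derivatives of a sum are sums of partial derivatives, by [steps_proper]; the
    bound on the gradient that is averaged over clusters thus applies to their
    joint log-likelihood. *)
Lemma max_partial_sum theta : Theta theta ->
  max_partial Theta F theta <= \sum_(j < m) max_partial Theta (f j) theta.
Proof.
move=> Tt; apply/bigmax_leP; split.
  by apply: sumr_ge0 => j _; exact: max_partial_ge0.
move=> c _; rewrite {1}/partial; case: asboolP => ex; last first.
  by rewrite normr0; apply: sumr_ge0 => j _; exact: max_partial_ge0.
have PF := steps_proper Tt ex.
rewrite (cvg_lim _ (sum_quotient_cvg Tt ex))//.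
apply: (le_trans (ler_norm_sum _ _ _)); apply: ler_sum => j _.
exact: partial_le_max.
Qed.

End SumOfPartials.

(** * Finite nets *)

Section Nets.
Context {R : realType} {d : nat}.
Implicit Types x y z : 'rV[R]_d.

Lemma cell_representatives (T : pointedType) (F : finType) (kappa : T -> F) (A : set T) :
  exists s : seq T, [/\ {in s, forall y : T, A y}, (size s <= #|F|)%N &
    forall x : T, A x -> exists2 y, y \in s & kappa y = kappa x].
Proof.
pose rep c := get (A `&` kappa @^-1` [set c]).
have repP (x : T) : A x -> (A `&` kappa @^-1` [set kappa x]) (rep (kappa x)).
  by move=> Ax; apply: (@getI _ _ x).
pose cells := [seq c <- enum F | `[< exists2 x, A x & kappa x = c >]].
exists [seq rep c | c <- cells]; split.
- move=> y /mapP[c]; rewrite mem_filter => /andP[/asboolP[x Ax <-] _] ->.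
  by have [] := repP x Ax.
- by rewrite size_map size_filter cardE count_size.
- move=> x Ax; exists (rep (kappa x)); last by have [] := repP x Ax.
  apply/mapP; exists (kappa x) => //.
  by rewrite mem_filter mem_enum andbT; apply/asboolP; exists x.
Qed.

(** The box is cut into cubic cells of side h, and each cell that meets A contributes one
    of its points in A: the net lies in A itself, so that it inherits every property
    that defines A. *)
Lemma box_net (A : set 'rV[R]_d) c (B h : R) : 0 < h <= B ->
  (forall x, A x -> `|x - c| <= B) ->
  exists s : seq 'rV[R]_d, [/\ {in s, forall y, A y},
    (size s)%:R <= (3 * B / h) ^+ d &
    forall x, A x -> exists2 y, y \in s & `|x - y| <= h].
Proof.
move=> /andP[h0 hB] AB; have B0 := lt_le_trans h0 hB.
pose n := Num.truncn (2 * B / h).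
pose u x i := (x 0 i - c 0 i + B) / h.
pose kappa x : {ffun 'I_d -> 'I_n.+1} := [ffun i => inord (Num.truncn (u x i))].
have uP x i : A x -> 0 <= u x i /\ (Num.truncn (u x i) < n.+1)%N.
  move=> /AB /(le_trans (coord_le_norm (x - c) i)); rewrite !mxE ler_norml => /andP[h1 h2].
  split; first by rewrite divr_ge0 ?(ltW h0)//; lra.
  by rewrite ltnS le_truncn// ler_pM2r ?invr_gt0//; lra.
have [s [sA sz sP]] := cell_representatives kappa A.
exists s; split => //.
  apply: (@le_trans _ _ (n.+1%:R ^+ d)).
    by rewrite -natrX ler_nat (leq_trans sz)// card_ffun !card_ord.
  rewrite lerXn2r ?nnegrE//; first by rewrite !mulr_ge0 ?invr_ge0 ?(ltW h0) ?(ltW B0).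
  have B1 : 1 <= B / h by rewrite ler_pdivlMr// mul1r.
  (* the last cell may stick out of the box; h <= B absorbs the extra 1 *)
rewrite -natr1 (@le_trans _ _ (2 * B / h + 1))//; last by rewrite -!mulrA; lra.
  by rewrite lerD2r truncn_le// !mulr_ge0 ?invr_ge0 ?(ltW h0) ?(ltW B0).
move=> x Ax; have [y ys kxy] := sP x Ax; exists y => //.
apply: norm_leP; first exact: ltW.
move=> i; have [ux0 uxn] := uP x i Ax; have [uy0 uyn] := uP y i (sA _ ys).
have /(congr1 val) : kappa y i = kappa x i by rewrite kxy.
rewrite !ffunE /= !inordK// => tt.
have /andP[a1 a2] := truncn_itv ux0; have /andP[b1 b2] := truncn_itv uy0.
rewrite tt in b1 b2; rewrite -natr1 in a2 b2.
have : `|u x i - u y i| <= 1 by rewrite ler_norml; apply/andP; split; lra.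
have -> : u x i - u y i = (x 0 i - y 0 i) / h by rewrite /u -mulrBl; congr (_ / _); ring.
by rewrite normrM normfV (gtr0_norm h0) ler_pdivrMr// mul1r !mxE.
Qed.

End Nets.

Section ShellNet.
Context {R : realType} {d : nat}.
Implicit Types x y : 'rV[R]_d.

Lemma ord_le1_eq (i j : 'I_d) : (d <= 1)%N -> i = j.
Proof.
move=> d1; apply: val_inj => /=.
have : (i < 1)%N by exact: leq_trans (ltn_ord i) d1.
have : (j < 1)%N by exact: leq_trans (ltn_ord j) d1.
by rewrite !ltnS !leqn0 => /eqP -> /eqP ->.
Qed.

Lemma shell_coord k x i : (d <= 1)%N -> shell k%:R (k%:R + 1) x ->
  k%:R <= `|x 0 i| < k%:R + 1.
Proof.
move=> d1 /andP[kx xk]; apply/andP; split; last first.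
  exact: le_lt_trans (le_trans (coord_le_norm x i) (norm_le_enorm x)) xk.
apply: (le_trans kx); apply: (le_trans (enorm_le_norm x)).
apply: (@le_trans _ _ `|x|); first by rewrite ler_piMl// (ler_nat R _ 1).
by apply: norm_leP => // j; rewrite (ord_le1_eq j i d1).
Qed.

(** In dimension one a shell is a pair of intervals, so that the size of the net does
    not grow with the radius. *)
Lemma shell_net (A : set 'rV[R]_d) (k : nat) (h : R) : (1 <= k)%N -> 0 < h <= 1 ->
  (forall x, A x -> shell k%:R (k%:R + 1) x) ->
  exists s : seq 'rV[R]_d, [/\ {in s, forall y, A y},
    (size s)%:R <= 2 * (6 / h) ^+ d * k%:R ^+ (d * (1 < d)%N) &
    forall x, A x -> exists2 y, y \in s & `|x - y| <= h].
Proof.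
move=> k1 /andP[h0 h1] Ak.
have k1R : 1 <= k%:R :> R by rewrite ler1n.
have hi0 : 0 <= h^-1 by rewrite invr_ge0 ltW.
have [d1|d1] := ltnP 1 d.
  have [|x /Ak/andP[_ xk]|s [sA sz sP]] := @box_net R d A 0 (2 * k%:R) h.
  - by rewrite h0 (le_trans h1)//; lra.
  - by rewrite subr0 (le_trans (norm_le_enorm x))//; lra.
  exists s; split=> //; rewrite muln1; apply: (le_trans sz).
  rewrite (_ : 3 * (2 * k%:R) / h = 6 / h * k%:R); last by field; rewrite gt_eqF.
  by rewrite exprMn -mulrA ler_peMl ?ler1n// mulr_ge0// exprn_ge0// mulr_ge0.
rewrite muln0 expr0 mulr1.
pose c (sgn : R) : 'rV[R]_d := const_mx (sgn * (k%:R + 2^-1)).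
have h11 : 0 < h <= 1 by rewrite h0.
have [x [Ax x0]|s1 [s1A s1z s1P]] :=
  @box_net R d [set x | A x /\ forall i, 0 <= x 0 i] (c 1) 1 h h11.
  apply: norm_leP => // i; rewrite !mxE mul1r.
  have /andP[] := shell_coord i d1 (Ak x Ax); rewrite ger0_norm// => a b.
  by rewrite ler_norml; apply/andP; split; lra.
have [x [Ax x0]|s2 [s2A s2z s2P]] :=
  @box_net R d [set x | A x /\ forall i, x 0 i <= 0] (c (-1)) 1 h h11.
  apply: norm_leP => // i; rewrite !mxE.
  have /andP[] := shell_coord i d1 (Ak x Ax); rewrite ler0_norm// => a b.
  by rewrite ler_norml; apply/andP; split; lra.
exists (s1 ++ s2); split.
- by move=> y; rewrite mem_cat => /orP[/s1A[]|/s2A[]].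
- rewrite size_cat natrD.
  have : (3 * 1 / h) ^+ d <= (6 / h) ^+ d.
    by rewrite lerXn2r ?nnegrE ?mulr_ge0// ler_wpM2r// mulr1 ler_nat.
  by move: s1z s2z; lra.
- move=> x Ax.
  have [x0|/existsNP[i /negP]] := pselect (forall i, 0 <= x 0 i).
    by have [y ys xy] := s1P x (conj Ax x0); exists y => //; rewrite mem_cat ys.
  rewrite -ltNge => xi.
  have x0 j : x 0 j <= 0.
    by rewrite (ord_le1_eq j i d1) ltW.
  by have [y ys xy] := s2P x (conj Ax x0); exists y => //; rewrite mem_cat ys orbT.
Qed.

End ShellNet.

(** * Discrete data and the subset argument *)

Section UnionBound.
Context {R : realType} {disp : measure_display} {T : measurableType disp}.
Variable P : probability T R.

Lemma measurable_exists_seq (I : eqType) (s : seq I) (A : I -> set T) :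
  (forall x, measurable (A x)) -> measurable [set w | exists2 x, x \in s & A x w].
Proof.
move=> mA; elim: s => [|a s ih].
  by rewrite (_ : [set w | _] = set0)//; apply/seteqP; split=> // w [].
rewrite (_ : [set w | _] = A a `|` [set w | exists2 x, x \in s & A x w]).
  exact: measurableU.
apply/seteqP; split=> [w [x]|w [Aw|[x xs Ax]]].
- by rewrite inE => /predU1P[->|xs Ax]; [left|right; exists x].
- by exists a => //; rewrite mem_head.
- by exists x => //; rewrite inE xs orbT.
Qed.

Lemma union_bound (I : eqType) (s : seq I) (A : I -> set T) (c : R) :
  (forall x, measurable (A x)) -> (forall x, x \in s -> (P (A x) <= c%:E)%E) ->
  (P [set w | exists2 x, x \in s & A x w] <= ((size s)%:R * c)%:E)%E.
Proof.
move=> mA; elim: s => [|a s ih] h.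
  by rewrite (_ : [set w | _] = set0) ?measure0 ?mul0r//; apply/seteqP; split=> // w [].
rewrite (_ : [set w | _] = A a `|` [set w | exists2 x, x \in s & A x w]); last first.
  apply/seteqP; split=> [w [x]|w [Aw|[x xs Ax]]].
  - by rewrite inE => /predU1P[->|xs Ax]; [left|right; exists x].
  - by exists a => //; rewrite mem_head.
  - by exists x => //; rewrite inE xs orbT.
apply: le_trans (measureU2 _ (mA a) (measurable_exists_seq s mA)) _.
rewrite /= -nat1r mulrDl mul1r EFinD; apply: leeD.
  by apply: h; rewrite mem_head.
by apply: ih => x xs; apply: h; rewrite inE xs orbT.
Qed.

Lemma le_probability (A B : set T) : measurable A -> measurable B ->
  A `<=` B -> (P A <= P B)%E.
Proof. by move=> mA mB; apply: le_measure; rewrite inE. Qed.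

End UnionBound.

Section Discrete.
Context {R : realType} {disp : measure_display} {T : measurableType disp}.
Context {N : nat}.
Variables (y : 'I_N -> {mfun T >-> R}) (V : set R).
Hypothesis cV : countable V.
Hypothesis yV : forall i w, V (y i w).

Lemma subvector_code (I : finType) (J : I -> 'I_N) :
  exists g : {ffun I -> R} -> nat, forall w w',
    g (subvector y J w) = g (subvector y J w') -> subvector y J w = subvector y J w'.
Proof.
have /countable_injP[g gi] := cV.
exists (fun t : {ffun I -> R} => pickle [ffun i => g (t i)]) => w w'.
move=> /(pcan_inj pickleK) /ffunP h; apply/ffunP => i; have := h i; rewrite !ffunE.
by apply: gi; rewrite inE; exact: yV.
Qed.

(** Q may be any set of values: its preimage is a countable union of events on which the
    vector is constant. *)
Lemma sigma_rv_subvector (I : finType) (J : I -> 'I_N) (Q : set {ffun I -> R}) :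
  sigma_rv (fun i => y (J i)) (subvector y J @^-1` Q).
Proof.
have [g gP] := subvector_code J.
pose G : set_system T := [set A | exists i, exists2 B, measurable B & A = y (J i) @^-1` B].
rewrite /sigma_rv -/G.
have -> : subvector y J @^-1` Q =
    \bigcup_n [set w | Q (subvector y J w) /\ g (subvector y J w) = n].
  apply/seteqP; split => [w Qw|w [n _ []]//]; by exists (g (subvector y J w)).
change (@measurable _ (g_sigma_algebraType G)
  (\bigcup_n [set w | Q (subvector y J w) /\ g (subvector y J w) = n])).
apply: bigcupT_measurable => n.
have [[w0 [Qw0 gw0]]|nex] := pselect (exists w, Q (subvector y J w) /\ g (subvector y J w) = n).
  rewrite (_ : [set w | _] = \bigcap_(i in [set: I]) (y (J i) @^-1` [set y (J i) w0])).
    apply: fin_bigcap_measurable => // i _; apply: sub_sigma_algebra.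
    by exists i; exists [set y (J i) w0].
  apply/seteqP; split=> w /=.
    move=> [Qw gw] i _ /=; have /gP/ffunP/(_ i) : g (subvector y J w) = g (subvector y J w0).
      by rewrite gw gw0.
    by rewrite !ffunE.
  move=> h; have -> : subvector y J w = subvector y J w0.
    by apply/ffunP => i; rewrite !ffunE; exact: h.
  by split.
rewrite (_ : [set w | _] = set0); first exact: measurable0.
by apply/seteqP; split=> // w h; apply: nex; exists w.
Qed.

Lemma sigma_rv_measurable (I : Type) (J : I -> 'I_N) (A : set T) :
  sigma_rv (fun i => y (J i)) A -> measurable A.
Proof.
apply: smallest_sub; first exact: sigma_algebra_measurable.
move=> _ [i [B mB ->]]; rewrite -[X in measurable X]setTI.
exact: (measurable_funPT (y (J i))).
Qed.

Lemma measurable_subvector (I : finType) (J : I -> 'I_N) (Q : set {ffun I -> R}) :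
  measurable [set w | Q (subvector y J w)].
Proof.
have h := @sigma_rv_subvector I J Q.
change (measurable (subvector y J @^-1` Q)).
exact: (sigma_rv_measurable h).
Qed.

(** For discrete data the mass functions may be compared pointwise: summing over
    the countably many values compares the probabilities of every event. *)
Lemma change_of_measure (P P' : probability T R) (I : finType) (J : I -> 'I_N)
    (Q : set {ffun I -> R}) (c : R) :
  let W := subvector y J in
  (forall w, Q (W w) -> vpmf P W (W w) <= c * vpmf P' W (W w)) ->
  (P [set w | Q (W w)] <= c%:E * P' [set w | Q (W w)])%E.
Proof.
move=> W h; have [g gP] := subvector_code J.
pose F n := [set w | Q (W w) /\ g (W w) = n].
have mF n : measurable (F n) by exact: (measurable_subvector J (fun t => Q t /\ g t = n)).
have -> : [set w | Q (W w)] = \bigcup_n F n.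
  by apply/seteqP; split => [w Qw|w [n _ []]//]; exists (g (W w)).
have tF : trivIset setT F.
  by apply/trivIsetP => i j _ _ ij; apply/seteqP; split => // w [[_ gi] [_ gj]];
    case/eqP: ij; rewrite -gi -gj.
rewrite !measure_bigcup// -nneseriesZl//; apply: lee_nneseries => // n _.
have [[w0 [Qw0 gw0]]|nex] := pselect (exists w, Q (W w) /\ g (W w) = n).
  have -> : F n = W @^-1` [set W w0].
    apply/seteqP; split => w /=.
      by move=> [Qw gw]; apply: gP; rewrite gw.
    by rewrite /F /= => ->.
  have := h w0 Qw0; rewrite /vpmf -lee_fin EFinM !fineK//; apply: fin_num_measure => //.
    exact: (measurable_subvector J [set W w0]).
  exact: (measurable_subvector J [set W w0]).
have -> : F n = set0 by apply/seteqP; split=> // w hw; apply: nex; exists w.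
by rewrite !measure0 mule0.
Qed.

Lemma vpmf_ge0 (P : probability T R) (I : finType) (J : I -> 'I_N) t :
  0 <= vpmf P (subvector y J) t.
Proof. by rewrite /vpmf fine_ge0. Qed.

Lemma vpmf_le1 (P : probability T R) (I : finType) (J : I -> 'I_N) t :
  vpmf P (subvector y J) t <= 1.
Proof.
have mt : measurable (subvector y J @^-1` [set t]) by exact: (measurable_subvector J [set t]).
rewrite /vpmf -lee_fin fineK; last exact: fin_num_measure.
exact: probability_le1.
Qed.

(** The subset argument.  Conditionally on a part of the data, the expectation
    of the full likelihood ratio is the likelihood ratio of that part; hence
    where the latter is at most r, the former exceeds 1/c with probability at
    most c r, whatever the dependence between the part and the rest. *)
Lemma subset_argument (P P0 : probability T R) (I : finType) (J : I -> 'I_N) (r c : R) :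
  let W := subvector y id in let WJ := subvector y J in
  0 <= r -> 0 <= c ->
  (P0 [set w | (vpmf P WJ (WJ w) <= r * vpmf P0 WJ (WJ w))%R /\
              (vpmf P0 W (W w) <= c * vpmf P W (W w))%R] <= (c * r)%:E)%E.
Proof.
move=> W WJ r0 c0.
pose sub (t : {ffun 'I_N -> R}) : {ffun I -> R} := [ffun i => t (J i)].
have subE w : sub (W w) = WJ w by apply/ffunP => i; rewrite !ffunE.
pose QJ : set {ffun I -> R} := [set t | vpmf P WJ t <= r * vpmf P0 WJ t].
pose Q : set {ffun 'I_N -> R} := [set t | QJ (sub t) /\ vpmf P0 W t <= c * vpmf P W t].
rewrite (_ : [set w | _] = [set w | Q (W w)]); last first.
  by apply/seteqP; split => w; rewrite /Q /= subE.
apply: (le_trans (@change_of_measure P0 P _ id Q c _)); first by move=> w [].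
rewrite EFinM lee_wpmul2l ?lee_fin//.
apply: (@le_trans _ _ (P [set w | QJ (WJ w)])).
  apply: le_probability; [exact: measurable_subvector|exact: measurable_subvector|].
  by move=> w [+ _]; rewrite subE.
apply: (le_trans (@change_of_measure P P0 _ J QJ r _)) => //.
rewrite -[leRHS]mule1 lee_wpmul2l ?lee_fin//.
by apply: probability_le1; exact: measurable_subvector.
Qed.

(** Indexing by a dependent sum joins clusters of different sizes into a single part of
    the data, to which [subset_argument] applies. *)
Definition glue (m : nat) (I : 'I_m -> finType) (J : forall j, I j -> 'I_N)
  (x : {j : 'I_m & I j}) : 'I_N := J (tag x) (tagged x).

Lemma vpmf_glue (P : probability T R) (m : nat) (I : 'I_m -> finType)
    (J : forall j, I j -> 'I_N) w :
  independent P (fun j => sigma_rv (fun i => y (J j i))) ->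
  vpmf P (subvector y (glue J)) (subvector y (glue J) w) =
  \prod_(j < m) vpmf P (subvector y (J j)) (subvector y (J j) w).
Proof.
move=> ind.
have h j : sigma_rv (fun i => y (J j i)) (subvector y (J j) @^-1` [set subvector y (J j) w]).
  exact: sigma_rv_subvector.
have /= := ind (fun j => subvector y (J j) @^-1` [set subvector y (J j) w]) h.
rewrite {1}/vpmf (_ : \bigcap_j _ = subvector y (glue J) @^-1` [set subvector y (glue J) w]).
  by move=> ->.
apply/seteqP; split => w' /=.
  move=> hw; apply/ffunP => -[j i]; rewrite !ffunE /glue /=.
  by have /ffunP/(_ i) := hw j Logic.I; rewrite !ffunE.
move=> /ffunP hw j _ /=; apply/ffunP => i.
by have := hw (existT _ j i); rewrite !ffunE.
Qed.

End Discrete.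

(** * Chebyshev's inequality for independent variables *)

Section Chebyshev.
Context {R : realType} {disp : measure_display} {T : measurableType disp}.
Variable P : probability T R.
Local Open Scope ereal_scope.

(** Independence says that the law of (X, Y) is the product of the laws of X and of Y, so
    that the expectation of X Y is an iterated integral. *)
Lemma independent_expectationM (X Y : {mfun T >-> R}) :
  (X : T -> R) \in Lfun P 1 -> (Y : T -> R) \in Lfun P 1 ->
  ((X : T -> R) * (Y : T -> R))%R \in Lfun P 1 ->
  (forall A B, measurable A -> measurable B ->
     P (X @^-1` A `&` Y @^-1` B) = P (X @^-1` A) * P (Y @^-1` B)) ->
  'E_P[((X : T -> R) * (Y : T -> R))%R] = 'E_P[X] * 'E_P[Y].
Proof.
move=> X1 Y1 XY1 ind.
have mZ : measurable_fun [set: T] (fun w => (X w, Y w)).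
  exact: measurable_fun_pair.
pose Z : {mfun T >-> (R * R)%type} := mfun_Sub (mem_set mZ).
pose f (z : R * R) : \bar R := (z.1 * z.2)%:E.
have mf : measurable_fun [set: R * R] f.
  by apply/measurable_EFinP; exact: measurable_funM.
have eqm (A : set (R * R)) : measurable A ->
    (distribution P X \x distribution P Y) A = distribution P Z A.
  apply: product_measure_unique => A1 A2 mA1 mA2.
  rewrite /distribution /pushforward -ind//.
have iXY : P.-integrable setT (f \o Z).
  by move/Lfun1_integrable : XY1.
have iZ : (distribution P Z).-integrable setT f.
  apply/integrableP; split => //.
  rewrite ge0_integral_distribution//; last exact: measurableT_comp.
  by have /integrableP[] := iXY.
have iprod : (distribution P X \x distribution P Y).-integrable setT f.
  apply/integrableP; split => //.
  rewrite (eq_measure_integral (distribution P Z)); last by move=> A mA _; exact: eqm.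
  by have /integrableP[] := iZ.
transitivity (\int[P]_w (f \o Z) w); first by rewrite unlock.
rewrite -integral_distribution//.
rewrite (eq_measure_integral (distribution P X \x distribution P Y)); last first.
  by move=> A mA _; apply/esym; exact: eqm.
rewrite -integral12_prod_meas1//.
have iY : (distribution P Y).-integrable setT (EFin : R -> \bar R).
  apply/integrableP; split; first exact: EFin_measurable.
  rewrite ge0_integral_distribution//; last exact: measurableT_comp.
  by move/Lfun1_integrable/integrableP : Y1 => [].
have iX : (distribution P X).-integrable setT (EFin : R -> \bar R).
  apply/integrableP; split; first exact: EFin_measurable.
  rewrite ge0_integral_distribution//; last exact: measurableT_comp.
  by move/Lfun1_integrable/integrableP : X1 => [].
have EY : 'E_P[Y] = \int[distribution P Y]_y y%:E.
  rewrite integral_distribution//; first by rewrite unlock.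
  by move/Lfun1_integrable : Y1.
have EX : 'E_P[X] = \int[distribution P X]_x x%:E.
  rewrite integral_distribution//; first by rewrite unlock.
  by move/Lfun1_integrable : X1.
rewrite (eq_integral (fun x : R => x%:E * 'E_P[Y])); last first.
  by move=> x _; rewrite /fubini_F EY -integralZl.
have finY : 'E_P[Y] \is a fin_num by exact: expectation_fin_num.
rewrite -(fineK finY) EX.
by rewrite integralZr.
Qed.

Lemma sqr_integrable_Lfun2 (X : {mfun T >-> R}) :
  \int[P]_w (X w ^+ 2)%:E < +oo -> (X : T -> R) \in Lfun P 2%:E.
Proof.
move=> h; rewrite inE; apply/andP; split; first by rewrite inE /=.
rewrite inE /= /finite_norm unlock /=.
apply: poweR_lty.
rewrite (_ : integral _ _ _ = \int[P]_w (X w ^+ 2)%:E)//.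
by apply: eq_integral => w _; rewrite /= powR_mulrn// real_normK ?num_real.
Qed.

(** The variance is centred at [fine 'E_P[X]], a real number whether or not X is
    integrable.  Its finiteness thus makes X square integrable about some real
    number, hence square integrable. *)
Lemma finite_variance_Lfun2 (X : {mfun T >-> R}) :
  'V_P[X] < +oo -> (X : T -> R) \in Lfun P 2%:E.
Proof.
rewrite /variance unlock unlock => h.
set e := fine _ in h.
have h' : ((X \- cst e)%R : T -> R) \in Lfun P 2%:E.
  by have := @sqr_integrable_Lfun2 (X \- cst e)%R; apply.
rewrite (_ : (X : T -> R) = ((X \- cst e) \+ cst e)%R); last first.
  by apply/funext => w /=; rewrite subrK.
by rewrite rpredD ?lee1n//= Lfun_cst.
Qed.

Lemma variance_sum_uncorrelated (m : nat) (X : 'I_m -> {mfun T >-> R}) :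
  (forall j, (X j : T -> R) \in Lfun P 2%:E) ->
  (forall i j, i != j -> covariance P (X i) (X j) = 0) ->
  forall s : seq 'I_m, uniq s ->
  ((fun w => \sum_(j <- s) X j w)%R : T -> R) \in Lfun P 2%:E /\
  'V_P[(fun w => \sum_(j <- s) X j w)%R] = \sum_(j <- s) 'V_P[X j].
Proof.
move=> X2 cov0 s us.
have L2 (r : seq 'I_m) : ((fun w => \sum_(j <- r) X j w)%R : T -> R) \in Lfun P 2%:E.
  elim: r => [|a r ih].
    rewrite (_ : (fun _ => _) = cst 0%R); first exact: Lfun_cst.
    by apply/funext => w; rewrite big_nil.
  rewrite (_ : (fun _ => _) = (X a \+ (fun w => \sum_(j <- r) X j w))%R).
    by rewrite rpredD ?lee1n//=.
  by apply/funext => w; rewrite big_cons.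
have C0 (r : seq 'I_m) a : a \notin r ->
    covariance P (fun w => \sum_(j <- r) X j w)%R (X a) = 0.
  elim: r => [_|b r ih].
    rewrite (_ : (fun _ => _) = cst 0%R); first by rewrite covariance_cst_l.
    by apply/funext => w; rewrite big_nil.
  rewrite inE negb_or => /andP[ab ar].
  rewrite (_ : (fun _ => _) = (X b \+ (fun w => \sum_(j <- r) X j w))%R); last first.
    by apply/funext => w; rewrite big_cons.
  by rewrite covarianceDl// ih// cov0 ?add0e// eq_sym.
split => //; elim: s us => [_|a s ih /= /andP[as_ us]].
  rewrite (_ : (fun _ => _) = cst 0%R); first by rewrite variance_cst big_nil.
  by apply/funext => w; rewrite big_nil.
rewrite (_ : (fun _ => _) = (X a \+ (fun w => \sum_(j <- s) X j w))%R); last first.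
  by apply/funext => w; rewrite big_cons.
by rewrite varianceD// ih// covarianceC C0// mule0 adde0 big_cons.
Qed.

(** Independence of the family restricts to pairs, by taking the whole space for the
    other events; so covariances vanish and the variance of the sum is the sum of
    the variances. *)
Lemma chebyshev_independent (m : nat) (F : 'I_m -> set_system T) (X : 'I_m -> {mfun T >-> R}) (eps : R) :
  independent P F -> (forall j B, measurable B -> F j (X j @^-1` B)) ->
  (forall j, 'V_P[X j] < +oo) -> (0 < eps)%R ->
  P [set w | (eps <= `|\sum_(j < m) (X j w - fine 'E_P[X j])|)%R] <=
    (eps ^- 2)%:E * \sum_(j < m) 'V_P[X j].
Proof.
move=> ind FX VX e0.
have X2 j := finite_variance_Lfun2 (VX j).
have Pfin : P setT \is a fin_num := fin_num_measure P _ measurableT.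
have X1 j := Lfun_subset12 Pfin (X2 j).
have FT j : F j setT by rewrite -(preimage_setT (X j)); exact: FX.
have pairind i j (A B : set R) : i != j -> measurable A -> measurable B ->
    P (X i @^-1` A `&` X j @^-1` B) = P (X i @^-1` A) * P (X j @^-1` B).
  move=> ij mA mB.
  have fP k C : measurable C -> P (X k @^-1` C) \is a fin_num.
    by move=> mC; apply: fin_num_measure; rewrite -[X in measurable X]setTI; exact: measurable_funPT.
  pose E k := if k == i then X i @^-1` A else if k == j then X j @^-1` B else setT.
  have FE k : F k (E k).
    rewrite /E; case: eqVneq => [->|_]; first exact: FX.
    by case: eqVneq => [->|_]; [exact: FX|exact: FT].
  have := ind E FE.
  rewrite (bigD1 i)//= (bigD1 j) 1?eq_sym//= big1 => [|k /andP[ki kj]]; last first.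
    by rewrite /E (negbTE ki) (negbTE kj) probability_setT.
  rewrite mulr1 {2 3}/E !eqxx eq_sym (negbTE ij) EFinM !fineK ?fP// => <-.
  congr (P _); apply/seteqP; split => w.
    move=> [Aw Bw] k _; rewrite /E; case: eqP => // _.
    by case: eqP.
  move=> h; split.
    by have := h i Logic.I; rewrite /E eqxx.
  by have := h j Logic.I; rewrite /E eqxx eq_sym (negbTE ij).
have cov0 i j : i != j -> covariance P (X i) (X j) = 0.
  move=> ij; have XY1 := Lfun2_mul_Lfun1 (X2 i) (X2 j).
  rewrite covarianceE// independent_expectationM//; last by move=> A B; exact: pairind.
  by rewrite subee// fin_numM// expectation_fin_num.
have [S2 VS] := variance_sum_uncorrelated X2 cov0 (index_enum_uniq 'I_m).
have mS : measurable_fun [set: T] (fun w => \sum_(j < m) X j w)%R.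
  exact: measurable_sum.
pose S : {mfun T >-> R} := mfun_Sub (mem_set mS).
have ES : fine 'E_P[S] = (\sum_(j < m) fine 'E_P[X j])%R.
  rewrite (_ : 'E_P[S] = \sum_(j < m) 'E_P[X j]).
    apply: EFin_inj; rewrite -sumEFin fineK; last first.
      by apply/sum_fin_numP => j _ _; exact: expectation_fin_num.
    by apply: eq_bigr => j _; rewrite fineK// expectation_fin_num.
  rewrite unlock /= -integral_sum//.
    by apply: eq_integral => w _; rewrite -sumEFin.
  by move=> j; have /Lfun1_integrable := X1 j.
have := @chebyshev _ _ _ P S eps e0.
rewrite ES (_ : 'V_P[S] = \sum_(j < m) 'V_P[X j])//.
move=> h; apply: le_trans h; rewrite le_eqVlt; apply/orP; left; apply/eqP; congr (P _).
by apply/seteqP; split => w /=; rewrite sumrB.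
Qed.

End Chebyshev.

Section FiniteMean.
Context {R : realType} {disp : measure_display} {T : measurableType disp}.

Lemma finite_variance_mean (P : probability T R) (X : T -> R) :
  measurable_fun [set: T] X -> ('V_P[X] < +oo)%E -> 'E_P[X]%E \is a fin_num.
Proof.
move=> mX VX; pose X' : {mfun T >-> R} := mfun_Sub (mem_set mX).
have X2 : (X' : T -> R) \in Lfun P 2%:E by exact: finite_variance_Lfun2.
have Pfin : P setT \is a fin_num := fin_num_measure P _ measurableT.
by have := expectation_fin_num (Lfun_subset12 Pfin X2).
Qed.

End FiniteMean.

Section DiscreteChebyshev.
Context {R : realType} {disp : measure_display} {T : measurableType disp}.
Context {N : nat}.
Variables (y : 'I_N -> {mfun T >-> R}) (V : set R).
Hypothesis cV : countable V.
Hypothesis yV : forall i w, V (y i w).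

(** The functions phi are arbitrary, since the vectors take countably many values. *)
Lemma discrete_chebyshev (P : probability T R) (m : nat) (I : 'I_m -> finType)
    (J : forall j, I j -> 'I_N) (phi : forall j, {ffun I j -> R} -> R) (eps : R) :
  let X j w := phi j (subvector y (J j) w) in
  independent P (fun j => sigma_rv (fun i => y (J j i))) ->
  (forall j, ('V_P[X j] < +oo)%E) -> 0 < eps ->
  (P [set w | (eps <= `|\sum_(j < m) (X j w - fine 'E_P[X j])|)%R] <=
    (eps ^- 2)%:E * \sum_(j < m) 'V_P[X j])%E.
Proof.
move=> X ind VX eps0.
have mX j : measurable_fun [set: T] (X j).
  move=> _ B mB; rewrite setTI.
  exact: (measurable_subvector cV yV (J j) (phi j @^-1` B)).
pose X' j : {mfun T >-> R} := mfun_Sub (mem_set (mX j)).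
apply: (@chebyshev_independent _ _ _ P m _ X' eps ind) => // j B mB.
exact: (sigma_rv_subvector cV yV (J := J j) (phi j @^-1` B)).
Qed.

End DiscreteChebyshev.

(** * Likely events and asymptotic bounds *)

Section Likely.
Context {R : realType} {disp : measure_display} {T : measurableType disp}.
Variable P : probability T R.

(** The exceptional event is bounded by a measurable one because Q, a statement about
    all parameters at once or one that holds almost everywhere, need not be
    measurable. *)
Definition likely (tau : R) (Q : set T) : Prop :=
  exists B, [/\ measurable B, (P B <= tau%:E)%E & forall w, ~ B w -> Q w].

Lemma likelyI tau tau' (Q Q' : set T) : likely tau Q -> likely tau' Q' ->
  likely (tau + tau') [set w | Q w /\ Q' w].
Proof.
move=> [B [mB PB QB]] [B' [mB' PB' QB']]; exists (B `|` B'); split.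
- exact: measurableU.
- by rewrite EFinD (le_trans (measureU2 _ mB mB'))// leeD.
- by move=> w nB; split; [apply: QB|apply: QB'] => ?; apply: nB; [left|right].
Qed.

Lemma sub_likely tau (Q Q' : set T) : (forall w, Q w -> Q' w) -> likely tau Q -> likely tau Q'.
Proof. by move=> QQ' [B [mB PB QB]]; exists B; split=> // w /QB /QQ'. Qed.

Lemma le_likely tau tau' (Q : set T) : tau <= tau' -> likely tau Q -> likely tau' Q.
Proof.
by move=> tt [B [mB PB QB]]; exists B; split=> //; rewrite (le_trans PB)// lee_fin.
Qed.

Lemma likely_forall_fin (m : nat) (Q : 'I_m -> set T) tau :
  (forall j, likely tau (Q j)) -> likely (m%:R * tau) [set w | forall j, Q j w].
Proof.
move=> /choice[B hB].
exists [set w | exists2 j, j \in enum 'I_m & B j w]; split.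
- by apply: measurable_exists_seq => j; have [] := hB j.
- have -> : m%:R * tau = (size (enum 'I_m))%:R * tau by rewrite size_enum_ord.
  by apply: union_bound => j *; have [] := hB j.
- move=> w nB j; have [_ _] := hB j; apply => Bw; apply: nB; exists j => //.
  by rewrite mem_enum.
Qed.

End Likely.

Lemma near_forall_fin (I : finType) (Q : I -> nat -> Prop) :
  (forall i, \forall N \near \oo, Q i N) -> \forall N \near \oo, forall i, Q i N.
Proof.
move=> h.
have /choice[n hn] i : exists n, forall N, (n <= N)%N -> Q i N.
  by have [n _ hn] := h i; exists n.
exists (\max_i n i) => // N /= hN i; apply: hn; exact: leq_trans (leq_bigmax i) hN.
Qed.

Section Growth.
Context {R : realType}.

(** The power of [max (s N) 1] is the number of points of a net of mesh 1 / s.  As log s is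
    negligible against m, it is at most exp (lam m / 2) eventually, which leaves a
    factor exp (- lam m / 2) to absorb K / tau. *)
Lemma subexponential_growth (s : nat -> R) (m : nat -> nat) (d : nat) (lam K tau : R) :
  (forall N, 0 < s N) -> (ln (s N) / (m N)%:R) @[N --> \oo] --> (0 : R) ->
  m @ \oo --> \oo -> 0 < lam -> 0 < tau -> 0 <= K ->
  \forall N \near \oo, K * Num.max (s N) 1 ^+ d * expR (- lam * (m N)%:R) <= tau.
Proof.
move=> s0 sm moo lam0 tau0 K0.
(* chosen so that d eta <= lam / 2 *)
pose eta := lam / (2 * (d%:R + 1)).
have d0 : 0 < d%:R + 1 :> R by rewrite ltr_wpDl.
have eta0 : 0 < eta by rewrite divr_gt0// mulr_gt0.
have small : \forall N \near \oo, `|ln (s N) / (m N)%:R| < eta.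
  by move/cvgr0Pnorm_lt : sm; apply.
pose k := Num.truncn (K / tau * 2 / lam).
have large : \forall N \near \oo, (k < m N)%N.
  by apply: (moo [set n | (k < n)%N]); exists k.+1.
apply: filterS2 small large => N h1 h2.
have m0 : 0 < (m N)%:R :> R by rewrite ltr0n (leq_ltn_trans _ h2).
have lns : ln (s N) <= eta * (m N)%:R.
  rewrite -ler_pdivrMr//; exact: le_trans (ler_norm _) (ltW h1).
have maxs : Num.max (s N) 1 <= expR (eta * (m N)%:R).
  rewrite ge_max -{1}(lnK (s0 N)) ler_expR lns /=.
  by rewrite -expR0 ler_expR mulr_ge0// ltW.
have maxd : Num.max (s N) 1 ^+ d <= expR (lam / 2 * (m N)%:R).
  apply: (@le_trans _ _ (expR (eta * (m N)%:R) ^+ d)).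
    by rewrite lerXn2r ?nnegrE// ?expR_ge0// le_max ler01 orbT.
  rewrite -expRM_natl ler_expR mulrA ler_wpM2r//.
  have -> : lam / 2 = (d%:R + 1) * eta by rewrite /eta; field; rewrite gt_eqF.
  by rewrite ler_wpM2r ?(ltW eta0)// lerDl.
rewrite -mulrA (@le_trans _ _ (K * (expR (lam / 2 * (m N)%:R) * expR (- lam * (m N)%:R))))//.
  by rewrite ler_wpM2l// ler_wpM2r// expR_ge0.
rewrite -expRD (_ : _ + _ = - (lam / 2 * (m N)%:R)); last by field.
rewrite expRN ler_pdivrMr ?expR_gt0// mulrC -ler_pdivrMr//.
have h3 : K / tau * 2 / lam < (m N)%:R.
  rewrite (lt_le_trans (truncnS_gt _))// ler_nat//.
have : K / tau <= lam / 2 * (m N)%:R.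
  by move/ltW: h3; rewrite ler_pdivrMr// -ler_pdivlMr// => /le_trans; apply; rewrite [leRHS]mulrC mulrA mulrAC.
by move/le_trans; apply; rewrite (le_trans _ (expR_ge1Dx _))// lerDr.
Qed.

End Growth.

Section EventualBounds.
Context {R : realType}.
Local Open Scope ereal_scope.

Lemma cvge0_near_lt (u : nat -> \bar R) (eta : R) : u @ \oo --> 0 -> (0 < eta)%R ->
  \forall N \near \oo, u N < eta%:E.
Proof.
move=> u0 eta0; apply: (u0 [set x | x < eta%:E]).
change (nbhs (0%R : R) [set r : R | r%:E < eta%:E]).
apply/nbhs_ballP; exists eta => //= r.
by rewrite /ball /= sub0r normrN lte_fin => /(le_lt_trans (ler_norm r)).
Qed.

Lemma near_le_cvge0 (u : nat -> \bar R) : (forall N, 0 <= u N) ->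
  (forall tau : R, (0 < tau)%R -> \forall N \near \oo, u N <= tau%:E) -> u @ \oo --> 0.
Proof.
move=> u0 h A A0; have {A0} : nbhs (0%R : R) (fun r : R => A r%:E) by [].
move=> /nbhs_ballP[e /= e0 eA].
have e2 : (0 < e / 2)%R by rewrite divr_gt0.
apply: filterS (h _ e2) => N uN.
change (A (u N)).
have := u0 N; case: (u N) uN => [r| |]//; rewrite !lee_fin => re r0.
apply: eA; rewrite /ball /= sub0r normrN ger0_norm//.
by rewrite (le_lt_trans re)// ltr_pdivrMr// ltr_pMr// ltr1n.
Qed.

Lemma limn_esup_lt0 (u : nat -> \bar R) : limn_esup u < 0 ->
  exists2 lam : R, (0 < lam)%R & \forall N \near \oo, u N <= (- lam)%:E.
Proof.
move=> /ereal_inf_lt[_ [V FV <-]] sV.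
have [lam lam0 Vlam] : exists2 lam : R, (0 < lam)%R & ereal_sup (u @` V) <= (- lam)%:E.
  move: sV; case: (ereal_sup _) => [r| |] //= r0.
    by exists (- r)%R; rewrite ?oppr_gt0// opprK.
  by exists 1%R => //; rewrite leNye.
exists lam => //; apply: filterS FV => N VN; apply: le_trans Vlam.
by apply: ereal_sup_ubound; exists N.
Qed.

End EventualBounds.

Section SupBound.
Context {R : realType}.

Lemma ereal_sup_bound (U : Type) (f : U -> R) (A : set U) (C : R) u :
  ~ (C%:E < `|ereal_sup [set (f u)%:E | u in A]|)%E -> A u -> f u <= C.
Proof.
move=> /negP; rewrite -leNgt => supC Au; rewrite -lee_fin (le_trans _ supC)//.
rewrite (le_trans _ (lee_abs _))//; apply: ereal_sup_ubound; by exists u.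
Qed.

End SupBound.

Section SeriesBound.
Context {R : realType}.

(** Indices between K and K2 have empty events, so that the whole series from K, whose
    smallness is given, bounds a union that starts at any later index. *)
Lemma series_union_bound disp (T : measurableType disp) (P : probability T R)
    (F : nat -> set T) (u : nat -> R) (A : R) (K K2 : nat) : (K <= K2)%N ->
  (forall k, measurable (F k)) -> (forall k, 0 <= u k) -> 0 <= A ->
  (forall k, (K2 <= k)%N -> (P (F k) <= (A * u k)%:E)%E) ->
  (P (\bigcup_(k in [set k | (K2 <= k)%N]) F k) <= A%:E * \sum_(K <= k <oo) (u k)%:E)%E.
Proof.
move=> KK mF u0 A0 PF.
pose G k := if (K2 <= k + K)%N then F (k + K)%N else set0.
have mG k : measurable (G k) by rewrite /G; case: ifP.
apply: (@le_trans _ _ (P (\bigcup_k G k))).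
  apply: le_probability; [exact: bigcup_measurable|exact: bigcupT_measurable|].
  move=> w [k /= kK Fk]; exists (k - K)%N => //.
  by rewrite /G subnK ?(leq_trans KK)// kK.
have mU : measurable (\bigcup_k G k) by exact: bigcupT_measurable.
apply: (le_trans (generalized_Boole_inequality P mG mU)).
rewrite -nneseriesZl; last by move=> k _; rewrite lee_fin.
rewrite -(nneseries_addn K (f := fun k => (A%:E * (u k)%:E)%E)); last first.
  by move=> k; rewrite mule_ge0// lee_fin.
apply: lee_nneseries => // k _; rewrite /G; case: ifPn => kK.
  by rewrite -EFinM; exact: PF.
by rewrite measure0 mule_ge0// lee_fin.
Qed.

End SeriesBound.

(** * Likelihoods of a mixed model *)

Section Positivity.
Context {R : realType} {p q : nat} {e : bool} {N : nat}.
Variables (Theta : set 'rV[R]_(p + (e + q))) (M : glmm R p q e N).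
Hypothesis gM : is_glmm Theta M.

(** Continuity of the function b on the domain of the natural parameter suffices, since
    the natural parameter never leaves that open set. *)
Lemma measurable_cond_pmf i theta t : Theta theta ->
  measurable_fun [set: Omega M] (fun w => cond_pmf i theta (reffv w) t).
Proof.
move=> Tt; apply: measurableT_comp => //.
apply: measurable_funD => //; apply: measurable_funM => //.
have mxi : measurable_fun [set: Omega M] (fun w => natpar M (eta i theta (reffv w))).
  apply: measurableT_comp; first exact: (glmm_natpar gM).
  apply: measurable_funD => //; rewrite /dot.
  apply: measurable_sum => k.
  rewrite (_ : (fun _ => _) = (fun w => cov_z M i 0 k * reff M k w)).
    by apply: measurable_funM.
  by apply/funext => w; rewrite mxE.
apply: measurable_funB; first by apply: measurable_funM.
apply: (measurable_comp (F := dom_xi M)).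
- exact: open_measurable (glmm_dom_xi gM).
- by move=> _ [w _ <-]; have [] := glmm_link gM i (reffv w) Tt.
- apply: open_continuous_measurable_fun; first exact: (glmm_dom_xi gM).
  move=> x; rewrite inE => /(glmm_b gM)[dx _].
  by apply: differentiable_continuous; exact/derivable1_diffP.
- exact: mxi.
Qed.

(** The conditional densities are exponentials, and the integral of a positive function
    against a probability is positive.  Since ln 0 = 0 by convention, this is what
    makes the log-likelihood ratios genuine. *)
Lemma lik_gt0 theta (I : finType) (J : I -> 'I_N) w : Theta theta ->
  0 < lik (M := M) theta J w.
Proof.
move=> Tt.
have msub (I' : finType) (J' : I' -> 'I_N) t : measurable (subvector (resp M) J' @^-1` [set t]).
  exact: (measurable_subvector (glmm_countable gM) (glmm_values gM) J' [set t]).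
pose t := data w.
pose g (w' : Omega M) := \prod_(i < N) cond_pmf i theta (reffv w') (t i).
have mg : measurable_fun [set: Omega M] g.
  by apply: measurable_prod => i _; exact: measurable_cond_pmf.
have g0 w' : 0 < g w' by apply: prodr_gt0 => i _; exact: expR_gt0.
have vt i : values M (t i) by rewrite /t ffunE; exact: (glmm_values gM).
have sT : sigma_rv (reff M) [set: Omega M].
  rewrite /sigma_rv; set G := (X in <<s X >>).
  exact: (@measurableT _ (g_sigma_algebraType G)).
have := glmm_cond gM Tt sT vt; rewrite setTI => dE.
have P0 : Pr M theta (data (M := M) @^-1` [set t]) != 0%E.
  rewrite dE; apply/eqP => int0.
  have mg' : measurable_fun [set: Omega M] (EFin \o g) by exact/measurable_EFinP.
  have : (\int[Pr M theta]_w' `|(EFin \o g) w'| = 0)%E.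
    rewrite -[RHS]int0; apply: eq_integral => w' _ /=.
    by rewrite gtr0_norm.
  move/(ae_eq_integral_abs (Pr M theta) measurableT mg') => [A [mA A0 h]].
  suff : (Pr M theta [set: Omega M] <= Pr M theta A)%E.
    by rewrite probability_setT A0 lee_fin ler10.
  apply: le_measure; rewrite ?inE//; apply: subset_trans h => w' _ /= /(_ Logic.I) [gw0].
  by have := g0 w'; rewrite gw0 ltxx.
rewrite /lik /vpmf fine_gt0//; apply/andP; split; last first.
  by rewrite ltey_eq fin_num_measure.
apply: (@lt_le_trans _ _ (Pr M theta (data (M := M) @^-1` [set t]))).
  by rewrite lt_neqAle eq_sym P0 measure_ge0.
apply: le_measure; rewrite ?inE; [exact: msub|exact: msub|].
by move=> w' /= /ffunP h; apply/ffunP => i; have := h (J i); rewrite !ffunE.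
Qed.

End Positivity.

Section OneModel.
Context {R : realType} {p q : nat} {e : bool} {N : nat}.
Variables (Theta : set 'rV[R]_(p + (e + q))) (M : glmm R p q e N).
Hypothesis gM : is_glmm Theta M.

(** Data with countably many values: every event that they determine is measurable. *)
Lemma measurable_data (A : set (Omega M)) :
  (forall w w' : Omega M, data w = data w' -> A w -> A w') -> measurable A.
Proof.
move=> h; rewrite (_ : A = [set w | ((data (M := M)) @` A) (data w)]).
  exact: (measurable_subvector (glmm_countable gM) (glmm_values gM) id
            ((data (M := M)) @` A)).
by apply/seteqP; split => w; [move=> Aw; exists w|move=> [w' Aw' /h]; apply].
Qed.

Lemma lik_data theta (I : finType) (J : I -> 'I_N) (w w' : Omega M) :
  data w = data w' -> lik theta J w = lik theta J w'.
Proof.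
move=> /ffunP ww'; rewrite /lik /=; congr (vpmf _ _ _); apply/ffunP => i.
by have := ww' (J i); rewrite !ffunE.
Qed.

Lemma logratioE theta theta0 (I : finType) (J : I -> 'I_N) w : Theta theta -> Theta theta0 ->
  logratio (M := M) theta theta0 J w = ln (lik theta J w) - ln (lik theta0 J w).
Proof. by move=> Tt T0; rewrite /logratio ln_div// posrE (lik_gt0 gM). Qed.

Lemma logratio_data theta theta0 (I : finType) (J : I -> 'I_N) (w w' : Omega M) :
  data w = data w' -> logratio theta theta0 J w = logratio theta theta0 J w'.
Proof. by move=> ww'; rewrite /logratio !(lik_data _ J ww'). Qed.

(** By independence under both parameters, the likelihood ratio of the joined clusters is
    the exponential of the sum of the log-ratios. *)
Lemma lik_subset_argument theta theta0 (m : nat) (I : 'I_m -> finType)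
    (J : forall j, I j -> 'I_N) (x c : R) : Theta theta -> Theta theta0 -> 0 <= c ->
  independent (Pr M theta) (fun j => sigma_rv (fun i => resp M (J j i))) ->
  independent (Pr M theta0) (fun j => sigma_rv (fun i => resp M (J j i))) ->
  (Pr M theta0 [set w | (\sum_(j < m) logratio (M := M) theta theta0 (J j) w <= x)%R /\
     (lik (M := M) theta0 id w <= c * lik (M := M) theta id w)%R] <= (c * expR x)%:E)%E.
Proof.
move=> Tt T0 c0 ind ind0.
pose A : set (Omega M) := [set w | lik theta (glue J) w <= expR x * lik theta0 (glue J) w /\
  lik theta0 id w <= c * lik theta id w].
apply: (@le_trans _ _ (Pr M theta0 A)); last first.
  exact: (subset_argument (glmm_countable gM) (glmm_values gM)
    (Pr M theta) (Pr M theta0) (glue J) (expR_ge0 x) c0).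
apply: le_probability; [apply: measurable_data|apply: measurable_data|].
- move=> w w' ww'; rewrite /= !(lik_data _ id ww').
  rewrite (eq_bigr (fun j => logratio theta theta0 (J j) w'))// => j _.
  exact: logratio_data.
- by move=> w w' ww'; rewrite /A /= !(lik_data _ id ww') !(lik_data _ (glue J) ww').
move=> w [h1 h2]; split=> //; rewrite /lik /=.
rewrite (vpmf_glue (glmm_countable gM) (glmm_values gM) w ind).
rewrite (vpmf_glue (glmm_countable gM) (glmm_values gM) w ind0).
rewrite -ler_pdivrMr; last by apply: prodr_gt0 => j _; exact: (lik_gt0 gM).
rewrite -prodf_div.
rewrite (_ : \prod_(j < m) _ = expR (\sum_(j < m) logratio (M := M) theta theta0 (J j) w)).
  by rewrite ler_expR.
rewrite expR_sum; apply: eq_bigr => j _.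
by rewrite /logratio lnK// posrE divr_gt0// (lik_gt0 gM).
Qed.

End OneModel.

Section NearbyLipschitz.
Context {R : realType} {p q : nat} {e : bool}.
Local Notation d := (p + (e + q))%N.
Variables (Theta : set 'rV[R]_d) (theta0 : 'rV[R]_d).
Hypothesis cT : convex_set Theta.
Hypothesis I0 : interior Theta theta0.

(** A sup norm ball of radius 1 / (d + 1) lies in the Euclidean unit ball, where the
    gradient bound is given; meshes up to 1 / (d + 2) stay strictly inside it. *)
Lemma ball_lipschitz f (L : R) x y : has_partials Theta f ->
  (forall u, Theta u -> enorm (u - x) <= 1 -> max_partial Theta f u <= L) ->
  Theta x -> Theta y -> `|x - y| <= d.+2%:R^-1 ->
  `|f y - f x| <= L * d%:R * `|x - y|.
Proof.
move=> pf bL Tx Ty xy; rewrite [`|x - y|]distrC.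
have bL' u : Theta u -> `|x - u| < d.+1%:R^-1 -> max_partial Theta f u <= L.
  move=> Tu xu; apply: bL => //; rewrite (le_trans (enorm_le_norm _))// distrC.
  rewrite (@le_trans _ _ (d%:R * d.+1%:R^-1))//; first by rewrite ler_wpM2l// ltW.
  by rewrite ler_pdivrMr// mul1r ler_nat.
apply: (convex_lipschitz cT pf bL' I0) => //; first by rewrite subrr normr0 invr_gt0.
by rewrite (le_lt_trans xy)// ltf_pV2 ?posrE// ltr_nat.
Qed.

Lemma nearbyW r r' x : r <= r' -> nearby Theta theta0 r x -> nearby Theta theta0 r' x.
Proof. by move=> rr' [Tx xr]; split=> //; exact: le_trans rr'. Qed.

Lemma nearby_lipschitz r f (L : R) x y : has_partials Theta f ->
  (forall u, nearby Theta theta0 (r + 1) u -> max_partial Theta f u <= L) ->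
  nearby Theta theta0 r x -> Theta y -> `|x - y| <= d.+2%:R^-1 ->
  `|f y - f x| <= L * d%:R * `|x - y|.
Proof.
move=> pf bL [Tx xr] Ty xy; apply: ball_lipschitz => // u Tu ux; apply: bL; split=> //.
have -> : u - theta0 = (x - theta0) + (u - x) by rewrite [RHS]addrC addrA subrK.
by rewrite (le_trans (enormD _ _))// lerD.
Qed.

Lemma nearby_norm r x : nearby Theta theta0 r x -> `|x - theta0| <= r.
Proof. by move=> [_]; exact: le_trans (norm_le_enorm _). Qed.

End NearbyLipschitz.

(** * Parameters at a bounded distance from the truth *)

Section LawOfLargeNumbers.
Context {R : realType} {p q : nat} {e : bool} {nb : nat}.
Local Notation d := (p + (e + q))%N.
Variables (M : forall N, glmm R p q e N) (Theta : set 'rV[R]_d) (theta0 : 'rV[R]_d).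
Variable S : forall N, 'I_nb.+1 -> subset_clusters N.
Arguments S : clear implicits.
Hypothesis cT : convex_set Theta.
Hypothesis gM : forall N, is_glmm Theta (M N).
Hypothesis I0 : interior Theta theta0.
Hypothesis hA1 : A1 M Theta S.

Let T0 : Theta theta0 := interior_subset I0.

Lemma clus_loglik_data N a j (w w' : Omega (M N)) : data w = data w' ->
  clus_loglik (S := S) (a := a) j w = clus_loglik j w'.
Proof. by move=> ww'; apply/funext => u; rewrite /clus_loglik (lik_data _ _ ww'). Qed.

Lemma full_loglik_data N (w w' : Omega (M N)) : data w = data w' ->
  full_loglik w = full_loglik w'.
Proof. by move=> ww'; apply/funext => u; rewrite /full_loglik (lik_data _ _ ww'). Qed.

Definition sum_logratio N a theta (w : Omega (M N)) : R :=
  \sum_(j < nclus (S N a)) logratio theta theta0 (@clus_idx N (S N a) j) w.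

Lemma sum_logratio_data N a theta (w w' : Omega (M N)) : data w = data w' ->
  sum_logratio a theta w = sum_logratio a theta w'.
Proof. by move=> ww'; apply: eq_bigr => j _; exact: logratio_data. Qed.

(** Chebyshev's inequality controls the points of a net of mesh of order 1 / sa, whose
    number sa^d is compensated by the variance condition, and the gradient bound
    carries the control to the other points.  The net is taken inside the set of
    parameters with mean at most - lam; so only sample means, and no expectations,
    are compared at neighbouring points. *)
Lemma cluster_lln a (sa : nat -> R) (kappa r lam tau : R) :
  0 < kappa -> (forall N, kappa <= sa N) -> 1 <= r -> 0 < lam -> 0 < tau ->
  (\forall N \near \oo, forall (w : Omega (M N)) j,
     has_partials Theta (clus_loglik (S := S) (a := a) j w)) ->
  negligible_in_prob theta0 (fun N (w : Omega (M N)) => ereal_sup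
    [set ((nclus (S N a))%:R^-1 * \sum_(j < nclus (S N a))
       max_partial Theta (clus_loglik (S := S) (a := a) j w) theta)%:E |
     theta in nearby Theta theta0 (r + 1)]) sa ->
  (fun N => ereal_sup
    [set ((sa N ^+ d / (nclus (S N a))%:R ^+ 2)%:E * \sum_(j < nclus (S N a))
       'V_(P0 M theta0 N)[logratio (M := M N) theta theta0 (@clus_idx N (S N a) j)])%E |
     theta in nearby Theta theta0 (r + 1)]) @ \oo --> 0%E ->
  \forall N \near \oo, likely (P0 M theta0 N) tau
    [set w | forall theta, nearby Theta theta0 r theta ->
       (mean_logratio M theta0 S N theta a <= (- lam)%:E)%E ->
       sum_logratio a theta w <= - (lam / 2) * (nclus (S N a))%:R].
Proof.
move=> kappa0 kappasa r1 lam0 tau0 hpd hneg hvar.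
have r0 : 0 < r by exact: lt_le_trans r1.
(* the mesh is kap / sa, at most 1 / (d + 2) because sa >= kappa *)
pose kap := kappa / d.+2%:R.
have kap0 : 0 < kap by rewrite divr_gt0.
(* gradients below eta2 sa per cluster change the sample mean by at most lam / 4
   over one mesh *)
pose eta2 := lam / (4 * d.+1%:R * kap).
have eta20 : 0 < eta2 by rewrite divr_gt0// !mulr_gt0.
pose C := (3 * r / kap) ^+ d.
have C0 : 0 < C by rewrite exprn_gt0// divr_gt0// mulr_gt0.
(* there are at most C sa^d net points, at each of which a deviation of the sample
   mean by lam / 4 has probability at most eta / (sa^d (lam / 4)^2) *)
pose eta := tau / 2 * (lam / 4) ^+ 2 / C.
have eta0 : 0 < eta by rewrite divr_gt0// mulr_gt0// ?divr_gt0// exprn_gt0// divr_gt0.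
have tau20 : 0 < tau / 2 by rewrite divr_gt0.
have [hI hm] := hA1 a.
have {}hm : \forall N \near \oo, (0 < nclus (S N a))%N.
  by apply: (hm [set n | (0 < n)%N]); exists 1%N.
have {}hneg := cvge0_near_lt (hneg _ eta20) tau20.
have {}hvar := cvge0_near_lt hvar eta0.
apply: filterS (filterI hI (filterI hm (filterI hneg (filterI hvar hpd)))).
move=> N [{}hI [{}hm [{}hneg [{}hvar {}hpd]]]].
set m := nclus (S N a) in hm hneg hvar *.
have m0 : 0 < m%:R :> R by rewrite ltr0n.
have s0 : 0 < sa N by exact: lt_le_trans (kappasa N).
pose h := kap / sa N.
have h0 : 0 < h by rewrite divr_gt0.
have hd : h <= d.+2%:R^-1.
  rewrite /h /kap ler_pdivrMr// mulrC ler_wpM2l// ?invr_ge0//.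
have hr : h <= r by rewrite (le_trans hd)// (le_trans _ r1)// invf_le1// ler1n.
pose P := P0 M theta0 N.
pose X theta j : Omega (M N) -> R := logratio theta theta0 (@clus_idx N (S N a) j).
pose A := [set theta | nearby Theta theta0 r theta /\
  (mean_logratio M theta0 S N theta a <= (- lam)%:E)%E].
have h0r : 0 < h <= r by rewrite h0 hr.
have [s [sA sz sP]] := box_net h0r (fun x (Ax : A x) => nearby_norm Ax.1).
have mX theta j : measurable_fun [set: Omega (M N)] (X theta j).
  move=> _ B mB; rewrite setTI; apply: (measurable_data (gM N)) => w w' ww'.
  by rewrite /preimage /= /X (logratio_data _ _ _ ww').
have sumV theta : nearby Theta theta0 r theta ->
    (\sum_(j < m) 'V_P[X theta j] <= (eta * m%:R ^+ 2 / sa N ^+ d)%:E)%E.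
  move=> Ttheta.
  have rr : r <= r + 1 by rewrite lerDl.
  have : ((sa N ^+ d / m%:R ^+ 2)%:E * \sum_(j < m) 'V_P[X theta j] <= eta%:E)%E.
    apply: le_trans (ltW hvar); apply: ereal_sup_ubound.
    by exists theta => //; exact: nearbyW Ttheta.
  rewrite -lee_pdivlMl ?divr_gt0 ?exprn_gt0// => /le_trans; apply.
  by rewrite -EFinM lee_fin invf_div mulrC mulrA.
have V0 theta j : (0 <= 'V_P[X theta j])%E by exact: variance_ge0.
have finV theta j : nearby Theta theta0 r theta -> ('V_P[X theta j] < +oo)%E.
  move=> /sumV sV; apply: (@le_lt_trans _ _ (\sum_(j < m) 'V_P[X theta j])%E).
    by rewrite (bigD1 j)//= leeDl// sume_ge0.
  by rewrite (le_lt_trans sV)// ltry.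
pose B theta := [set w | m%:R * (lam / 4) <=
  `|\sum_(j < m) (X theta j w - fine 'E_P[X theta j]%E)|].
have mB theta : measurable (B theta).
  apply: (measurable_data (gM N)) => w w' ww'; rewrite /B /= /X.
  by under eq_bigr do rewrite (logratio_data _ _ _ ww').
have PB theta : nearby Theta theta0 r theta ->
    (P (B theta) <= ((lam / 4) ^- 2 * eta / sa N ^+ d)%:E)%E.
  move=> nt.
  pose phi j t := ln (vpmf (Pr (M N) theta) (subvector (resp (M N)) (@clus_idx N (S N a) j)) t /
    vpmf (Pr (M N) theta0) (subvector (resp (M N)) (@clus_idx N (S N a) j)) t).
  have k0 : 0 < m%:R * (lam / 4) by rewrite mulr_gt0// divr_gt0.
  have := discrete_chebyshev (glmm_countable (gM N)) (glmm_values (gM N)) (P := P)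
    (J := fun j => @clus_idx N (S N a) j) (phi := phi) (hI theta0 T0)
    (fun j => finV theta j nt) k0.
  move=> /le_trans; apply.
  apply: (@le_trans _ _ (((m%:R * (lam / 4)) ^- 2)%:E * (eta * m%:R ^+ 2 / sa N ^+ d)%:E)%E).
    by rewrite lee_wpmul2l ?lee_fin ?invr_ge0 ?exprn_ge0 ?(ltW k0)//; exact: sumV.
  rewrite -EFinM lee_fin le_eqVlt; apply/orP; left; apply/eqP.
  by field; rewrite !gt_eqF// ?exprn_gt0.
pose Bs := [set w | exists2 theta, theta \in s & B theta w].
have mBs : measurable Bs by exact: measurable_exists_seq.
have PBs : (P Bs <= (tau / 2)%:E)%E.
  apply: (le_trans (union_bound mB (fun theta ts => PB theta (sA theta ts).1))).
  rewrite lee_fin.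
  apply: (@le_trans _ _ ((3 * r / h) ^+ d * ((lam / 4) ^- 2 * eta / sa N ^+ d))).
    by rewrite ler_wpM2r// divr_ge0 ?exprn_ge0 ?(ltW s0)// mulr_ge0 ?(ltW eta0)// invr_ge0 exprn_ge0// divr_ge0// ltW.
  rewrite (_ : 3 * r / h = 3 * r / kap * sa N); last first.
    by rewrite /h; field; rewrite !gt_eqF.
  rewrite exprMn -/C /eta le_eqVlt; apply/orP; left; apply/eqP.
  by field; rewrite !gt_eqF// ?exprn_gt0.
pose large (G : 'I_m -> 'rV[R]_d -> R) := ((eta2 * sa N)%:E < `|ereal_sup
    [set (m%:R^-1 * \sum_(j < m) max_partial Theta (G j) theta)%:E |
     theta in nearby Theta theta0 (r + 1)]|)%E.
pose D := [set w : Omega (M N) | large (fun j => clus_loglik (S := S) (a := a) j w)].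
have mD : measurable D.
  apply: (measurable_data (gM N)) => w w' ww'; rewrite /D /=.
  rewrite (_ : (fun j => clus_loglik j w) = (fun j => clus_loglik j w'))//.
  by apply/funext => j; exact: clus_loglik_data.
exists (D `|` Bs); split.
- exact: measurableU.
- apply: (le_trans (measureU2 _ mD mBs)).
  by rewrite [in leRHS](splitr tau) EFinD; apply: leeD => //; exact: ltW.
move=> w nDB theta nt mt.
have [y ys ty] := sP theta (conj nt mt).
have [ny my] := sA _ ys.
(* from - lam in mean at y, Chebyshev loses lam / 4 and the passage to theta another
   lam / 4 *)
pose F u := \sum_(j < m) clus_loglik (S := S) (a := a) j w u.
have sumE u : Theta u -> \sum_(j < m) X u j w = F u - F theta0.
  by move=> Tu; rewrite -sumrB; apply: eq_bigr => j _; rewrite /X (logratioE (gM N)).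
have LF u : nearby Theta theta0 (r + 1) u -> max_partial Theta F u <= eta2 * sa N * m%:R.
  move=> nu; apply: (le_trans (max_partial_sum cT (hpd w) nu.1)).
  rewrite -ler_pdivrMr// mulrC.
  apply: (ereal_sup_bound (f := fun u => m%:R^-1 * \sum_(j < m)
    max_partial Theta (clus_loglik (S := S) (a := a) j w) u) (u := u) _ nu).
  by move=> Dw; apply: nDB; left.
have := nearby_lipschitz cT I0 (has_partials_sum cT (hpd w)) LF nt ny.1 (le_trans ty hd).
rewrite -/(F y) -/(F theta) => Fy.
have {}Fy : `|F y - F theta| <= lam / 4 * m%:R.
  apply: (le_trans Fy).
  apply: (@le_trans _ _ (eta2 * sa N * m%:R * d.+1%:R * h)).
    have L0 : 0 <= eta2 * sa N * m%:R by apply/ltW/mulr_gt0 => //; exact: mulr_gt0.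
    apply: (@le_trans _ _ (eta2 * sa N * m%:R * d.+1%:R * `|theta - y|)).
      by rewrite ler_wpM2r// ler_wpM2l// ler_nat leqnSn.
    by rewrite ler_wpM2l// mulr_ge0.
  rewrite le_eqVlt; apply/orP; left; apply/eqP; rewrite /eta2 /h.
  by field; rewrite !gt_eqF.
have : \sum_(j < m) fine 'E_P[X y j]%E <= - lam * m%:R.
  move: my; rewrite /mean_logratio -/m -/P.
  rewrite (_ : (\sum_(j < m) _)%E = (\sum_(j < m) fine 'E_P[X y j]%E)%:E); last first.
    rewrite -sumEFin; apply: eq_bigr => j _; rewrite fineK//.
    exact: (finite_variance_mean (mX y j) (finV _ _ ny)).
  by rewrite -EFinM lee_fin mulrC ler_pdivrMr.
have : `|\sum_(j < m) (X y j w - fine 'E_P[X y j]%E)| < m%:R * (lam / 4).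
  by rewrite ltNge; apply/negP => By; apply: nDB; right; exists y.
rewrite sumrB (sumE y ny.1) /sum_logratio -/m.
have := sumE theta nt.1; rewrite /X => ->.
move: Fy; rewrite ler_norml ltr_norml => /andP[F1 F2] /andP[G1 G2] H1.
by lra.
Qed.

End LawOfLargeNumbers.

Section Annulus.
Context {R : realType} {p q : nat} {e : bool} {nb : nat}.
Local Notation d := (p + (e + q))%N.
Variables (M : forall N, glmm R p q e N) (Theta : set 'rV[R]_d) (theta0 : 'rV[R]_d).
Variable S : forall N, 'I_nb.+1 -> subset_clusters N.
Arguments S : clear implicits.
Hypothesis cT : convex_set Theta.
Hypothesis gM : forall N, is_glmm Theta (M N).
Hypothesis I0 : interior Theta theta0.
Hypothesis hA1 : A1 M Theta S.

Let T0 : Theta theta0 := interior_subset I0.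

Lemma min_nclus_le N a : (min_nclus S N <= nclus (S N a))%N.
Proof.
rewrite /min_nclus; have := mem_index_enum a.
elim: (index_enum _) => // b s ih; rewrite inE big_cons => /predU1P[->|/ih].
  exact: geq_minl.
by apply: leq_trans; exact: geq_minr.
Qed.

Lemma min_nclus_cvg : min_nclus S @ \oo --> \oo.
Proof.
move=> A [k _ kA].
have : \forall N \near \oo, forall a, (k <= nclus (S N a))%N.
  apply: near_forall_fin => a; have [_ hm] := hA1 a.
  by apply: (hm [set n | (k <= n)%N]); exists k.
apply: filterS => N kN; apply: kA => /=; rewrite /min_nclus.
by elim/big_ind : _ => // x y kx ky; rewrite leq_min kx.
Qed.

Lemma measurable_full_sup N (A : set 'rV[R]_d) (x : R) :
  measurable [set w : Omega (M N) |
    (x%:E < `|ereal_sup [set (max_partial Theta (full_loglik w) theta)%:E | theta in A]|)%E].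
Proof.
apply: (measurable_data (gM N)) => w w' ww' /=.
by rewrite (full_loglik_data ww').
Qed.

(** A bounded change of the full log-likelihood only costs a constant factor in the
    comparison with theta0. *)
Lemma lik_near N (w : Omega (M N)) x y (C : R) : Theta x -> Theta y ->
  `|full_loglik w y - full_loglik w x| <= C -> lik theta0 id w <= lik x id w ->
  lik theta0 id w <= expR C * lik y id w.
Proof.
move=> Tx Ty xy /le_trans; apply.
have px : 0 < lik (M := M N) x id w by exact: (lik_gt0 (gM N)).
have py : 0 < lik (M := M N) y id w by exact: (lik_gt0 (gM N)).
rewrite -ler_pdivrMr// -ler_ln ?posrE ?divr_gt0 ?expR_gt0// expRK ln_div//.
by rewrite (le_trans _ xy)// distrC ler_norm.
Qed.

(** The subset argument is applied at the points of a net of mesh of order 1 / max(s, 1),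
    with a subset of the data that depends on the point: some mean log-ratio is at
    most - lam there.  The number of points, of order max(s, 1)^d, is beaten by
    exp (- lam m / 2), where m is the smallest number of clusters, and the gradient
    bound on the full log-likelihood reduces every other parameter to a net point. *)
Lemma annulus_likely (r eps tau : R) : 1 <= r -> 0 < eps -> 0 < tau ->
  B2 M Theta theta0 S r -> B3 M Theta theta0 S (r + 1) ->
  \forall N \near \oo, likely (P0 M theta0 N) tau
    [set w | forall theta, nearby Theta theta0 r theta -> eps <= enorm (theta - theta0) ->
       lik theta id w < lik theta0 id w].
Proof.
move=> r1 eps0 tau0 [_ /(_ eps eps0) /limn_esup_lt0[lam lam0 hmean]].
move=> [s [sa [[s0 [kappa kappa0 kappasa]] hpd [hbd lns] hneg hvar]]].
have r0 : 0 < r by exact: lt_le_trans r1.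
have tau3 : 0 < tau / 3 by rewrite divr_gt0.
have taua : 0 < tau / 3 / nb.+1%:R by rewrite divr_gt0.
have [C C0 {}hbd] := hbd _ tau3.
have hlln : \forall N \near \oo, forall a, likely (P0 M theta0 N) (tau / 3 / nb.+1%:R)
    [set w | forall theta, nearby Theta theta0 r theta ->
       (mean_logratio M theta0 S N theta a <= (- lam)%:E)%E ->
       @sum_logratio R p q e nb M theta0 S N a theta w <= - (lam / 2) * (nclus (S N a))%:R].
  apply: near_forall_fin => a; apply: (cluster_lln cT gM I0 hA1 kappa0) => //.
  - by apply: filterS hpd => N h w j; have [_] := h w; exact.
  - by have [] := hneg a.
have hI : \forall N \near \oo, forall a, forall theta, Theta theta ->
    independent (Pr (M N) theta)
      (fun j => sigma_rv (fun i => resp (M N) (@clus_idx N (S N a) j i))).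
  by apply: near_forall_fin => a; have [] := hA1 a.
(* size of the net up to max(s, 1)^d, times the loss exp C of passing to a net point *)
pose K := (3 * r * d.+2%:R) ^+ d * expR C.
have K0 : 0 <= K by rewrite mulr_ge0 ?expR_ge0// exprn_ge0// !mulr_ge0// ltW.
have lam20 : 0 < lam / 2 by rewrite divr_gt0.
have hgrow := subexponential_growth d s0 lns min_nclus_cvg lam20 tau3 K0.
apply: filterS (filterI hmean (filterI hpd (filterI hbd (filterI hlln (filterI hI hgrow))))).
move=> N [{}hmean [{}hpd [{}hbd [{}hlln [{}hI {}hgrow]]]]].
pose st := Num.max (s N) 1.
have st1 : 1 <= st by rewrite le_max lexx orbT.
have st0 : 0 < st by exact: lt_le_trans st1.
pose h := d.+2%:R^-1 / st.
have h0 : 0 < h by rewrite divr_gt0// invr_gt0.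
have hd : h <= d.+2%:R^-1 by rewrite /h ler_pdivrMr// ler_peMr// invr_ge0.
have h0r : 0 < h <= r.
  by rewrite h0 (le_trans hd)// (le_trans _ r1)// invf_le1// ler1n.
pose A := [set theta | nearby Theta theta0 r theta /\ eps <= enorm (theta - theta0)].
have [net [netA netsz netP]] := box_net h0r (fun x (Ax : A x) => nearby_norm Ax.1).
pose P := P0 M theta0 N.
(* quantifying over every subset with small mean spares a choice of one per theta *)
pose E theta := [set w | forall a, (mean_logratio M theta0 S N theta a <= (- lam)%:E)%E ->
  @sum_logratio R p q e nb M theta0 S N a theta w <= - (lam / 2) * (nclus (S N a))%:R /\
  lik theta0 id w <= expR C * lik theta id w].
have mE theta : measurable (E theta).
  apply: (measurable_data (gM N)) => w w' ww' Ew a ma; have := Ew a ma.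
  by rewrite (@sum_logratio_data R p q e nb M theta0 S N a theta _ _ ww') !(lik_data _ id ww').
have exa theta : A theta -> exists a, (mean_logratio M theta0 S N theta a <= (- lam)%:E)%E.
  move=> At; apply/not_existsP => na; move: hmean.
  apply/negP; rewrite -ltNge.
  apply: (@lt_le_trans _ _ (\big[Order.min/mean_logratio M theta0 S N theta ord0]_(a < nb.+1)
              mean_logratio M theta0 S N theta a)); last first.
    by apply: ereal_sup_ubound; case: At => At1 At2; exists theta.
  have lt a : ((- lam)%:E < mean_logratio M theta0 S N theta a)%E.
    by rewrite ltNge; apply/negP; exact: na.
  by elim/big_ind : _ => // x y lx ly; rewrite lt_min lx.
have PE theta : A theta ->
    (P (E theta) <= (expR C * expR (- (lam / 2) * (min_nclus S N)%:R))%:E)%E.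
  move=> At; have [a ma] := exa theta At.
  have Tt := At.1.1.
  have := lik_subset_argument (gM N) (J := fun j => @clus_idx N (S N a) j)
    (- (lam / 2) * (nclus (S N a))%:R) Tt T0 (expR_ge0 C) (hI a _ Tt) (hI a _ T0).
  move=> h1; apply: (@le_trans _ _ (expR C * expR (- (lam / 2) * (nclus (S N a))%:R))%:E).
    apply: le_trans h1; apply: le_probability => //; last by move=> w /(_ a ma).
    apply: (measurable_data (gM N)) => w w' ww' /=.
    rewrite !(lik_data _ id ww') (eq_bigr (fun j => logratio theta theta0 (@clus_idx N (S N a) j) w'))//.
    by move=> j _; exact: logratio_data.
  rewrite lee_fin ler_wpM2l ?expR_ge0// ler_expR !mulNr lerN2 ler_wpM2l ?(ltW lam20)//.
  by rewrite ler_nat min_nclus_le.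
pose Es := [set w | exists2 theta, theta \in net & E theta w].
have mEs : measurable Es by exact: measurable_exists_seq.
have PEs : (P Es <= (tau / 3)%:E)%E.
  apply: (le_trans (union_bound mE (fun theta tn => PE theta (netA theta tn)))).
  rewrite lee_fin; apply: le_trans hgrow; rewrite -/st.
  apply: (@le_trans _ _ ((3 * r / h) ^+ d *
      (expR C * expR (- (lam / 2) * (min_nclus S N)%:R)))).
    by rewrite ler_wpM2r// mulr_ge0// expR_ge0.
  rewrite (_ : 3 * r / h = 3 * r * d.+2%:R * st); last first.
    by rewrite /h; field; rewrite !gt_eqF.
  by rewrite exprMn /K le_eqVlt; apply/orP; left; apply/eqP; ring.
have lE : likely P (tau / 3) [set w | ~ Es w] by exists Es; split.
pose D := [set w : Omega (M N) | ((C * s N)%:E < `|ereal_sup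
    [set (max_partial Theta (full_loglik w) theta)%:E |
     theta in nearby Theta theta0 (r + 1)]|)%E].
have mD : measurable D by exact: measurable_full_sup.
have lD : likely P (tau / 3) [set w | ~ D w] by exists D; split.
have := likelyI (likelyI lE lD) (likely_forall_fin hlln).
rewrite [X in likely _ (_ + X)](_ : _ = tau / 3); last by rewrite mulrC divfK// pnatr_eq0.
rewrite (_ : _ + _ = tau); last by field.
apply: sub_likely => w [[nE nD] Gw] theta nt et.
rewrite ltNge; apply/negP => ge0.
have [y ynet ty] := netP theta (conj nt et).
have Ay := netA _ ynet.
apply: nE; exists y => // a ma; split; first exact: (Gw a y Ay.1 ma).
have bL u : nearby Theta theta0 (r + 1) u -> max_partial Theta (full_loglik w) u <= C * st.
  move=> nu; apply: (@le_trans _ _ (C * s N)).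
    exact: (ereal_sup_bound (f := max_partial Theta (full_loglik w)) nD nu).
  by rewrite ler_wpM2l ?(ltW C0)// le_max lexx.
have := nearby_lipschitz cT I0 (hpd w).1 bL nt Ay.1.1 (le_trans ty hd).
move=> Ly; apply: (lik_near nt.1 Ay.1.1 _ ge0).
apply: (le_trans Ly); apply: (@le_trans _ _ (C * st * d.+2%:R * h)).
  have Cst0 : 0 <= C * st by apply/ltW/mulr_gt0.
  apply: (@le_trans _ _ (C * st * d.+2%:R * `|theta - y|)).
    by rewrite ler_wpM2r// ler_wpM2l// ler_nat leqW.
  by rewrite ler_wpM2l// mulr_ge0.
rewrite le_eqVlt; apply/orP; left; apply/eqP; rewrite /h.
by field; rewrite !gt_eqF.
Qed.

End Annulus.

(** * Parameters far from the origin *)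

Section FarClusters.
Context {R : realType} {p q : nat} {e : bool} {N : nat}.
Local Notation d := (p + (e + q))%N.
Variables (Theta : set 'rV[R]_d) (theta0 : 'rV[R]_d) (M : glmm R p q e N).
Hypothesis gM : is_glmm Theta M.
Hypothesis T0 : Theta theta0.
Variables (m len : nat) (J : 'I_m -> 'I_len -> 'I_N).
Hypothesis m0 : (0 < m)%N.

Let P := Pr M theta0.
Let W j := subvector (resp M) (J j).
Let pj theta j := vpmf (Pr M theta) (W j).

Lemma indicator_mean j t :
  'E_P[fun w => (W j w == t)%:R]%E = (pj theta0 j t)%:E.
Proof.
have mt : measurable (W j @^-1` [set t]).
  exact: (measurable_subvector (glmm_countable gM) (glmm_values gM) (J j) [set t]).
rewrite (_ : (fun w => _) = \1_(W j @^-1` [set t])).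
  by rewrite expectation_indic// /pj /vpmf fineK// fin_num_measure.
apply/funext => w; rewrite indicE (_ : (W j w == t) = (w \in W j @^-1` [set t]))//.
apply/idP/idP; first by move/eqP => wt; exact/mem_set.
by move=> /set_mem /= ->.
Qed.

Lemma indicator_variance j t : ('V_P[fun w => (W j w == t)%:R] <= 1)%E.
Proof.
rewrite /variance unlock indicator_mean /= unlock.
rewrite -(probability_setT P) -[leRHS]mul1e -integral_cst//.
have pj0 : 0 <= pj theta0 j t by exact: vpmf_ge0.
have pj1 : pj theta0 j t <= 1.
  exact: (vpmf_le1 (glmm_countable gM) (glmm_values gM)).
apply: ge0_le_integral => //.
- by move=> w _; rewrite lee_fin -expr2 sqr_ge0.
- have mX : measurable_fun [set: Omega M] (fun w => (W j w == t)%:R - pj theta0 j t : R).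
    move=> _ B mB; rewrite setTI; apply: (measurable_data gM) => w w' /ffunP ww'.
    rewrite /preimage /= (_ : W j w = W j w')//; apply/ffunP => i.
    by have := ww' (J j i); rewrite !ffunE.
  by apply/measurable_EFinP; apply: measurable_funM.
- move=> w _; rewrite lee_fin.
  change (((W j w == t)%:R - pj theta0 j t) * ((W j w == t)%:R - pj theta0 j t) <= 1).
  by move: (pj _ _ _) pj0 pj1 => x x0 x1; case: (_ == _) => /=; nra.
Qed.

(** Indicators have variance at most 1, so that Chebyshev's inequality gives order 1 / m
    for each value t, and the number of values is negligible against m. *)
Lemma frequency_likely (T : seq {ffun 'I_len -> R}) (rho rho' : R) :
  independent P (fun j => sigma_rv (fun i => resp M (J j i))) ->
  (forall t, t \in T -> rho <= m%:R^-1 * \sum_(j < m) pj theta0 j t) -> rho' < rho ->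
  likely P ((size T)%:R / m%:R / (rho - rho') ^+ 2)
    [set w | forall t, t \in T -> rho' * m%:R <= \sum_(j < m) (W j w == t)%:R].
Proof.
move=> ind hrho rr.
have mR : 0 < m%:R :> R by rewrite ltr0n.
have rr0 : 0 < rho - rho' by rewrite subr_gt0.
pose B t := [set w | m%:R * (rho - rho') <=
  `|\sum_(j < m) ((W j w == t)%:R - pj theta0 j t)|].
have mB t : measurable (B t).
  apply: (measurable_data gM) => w w' /ffunP ww'; rewrite /B /=.
  under eq_bigr => j _.
    rewrite (_ : W j w = W j w'); last by apply/ffunP => i; have := ww' (J j i); rewrite !ffunE.
    over.
  by [].
have PB t : (P (B t) <= ((m%:R * (rho - rho') ^+ 2)^-1)%:E)%E.
  have eps0 : 0 < m%:R * (rho - rho') by rewrite mulr_gt0.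
  have VX j : ('V_P[fun w => (W j w == t)%:R] < +oo)%E.
    by rewrite (le_lt_trans (indicator_variance j t))// ltry.
  have := discrete_chebyshev (glmm_countable gM) (glmm_values gM) (P := P) (J := J)
    (phi := fun j u => (u == t)%:R) ind VX eps0.
  rewrite (_ : [set w | _] = B t); last first.
    apply/seteqP; split => w /=; under eq_bigr do rewrite indicator_mean /=; exact.
  move=> /le_trans; apply.
  apply: (@le_trans _ _ (((m%:R * (rho - rho')) ^- 2)%:E * (m%:R)%:E)%E).
    rewrite lee_wpmul2l ?lee_fin ?invr_ge0 ?exprn_ge0 ?(ltW eps0)//.
    apply: (@le_trans _ _ (\sum_(j < m) 1%:E)%E).
      by apply: lee_sum => j _; exact: indicator_variance.
    by rewrite sumEFin sumr_const card_ord.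
  rewrite -EFinM lee_fin le_eqVlt; apply/orP; left; apply/eqP.
  by field; rewrite !gt_eqF.
exists [set w | exists2 t, t \in T & B t w]; split.
- exact: measurable_exists_seq.
- apply: (le_trans (union_bound mB (fun t _ => PB t))).
  by rewrite lee_fin invfM mulrA.
- move=> w nB t tT.
  have : `|\sum_(j < m) ((W j w == t)%:R - pj theta0 j t)| < m%:R * (rho - rho').
    by rewrite ltNge; apply/negP => Bw; apply: nB; exists t.
  rewrite sumrB ltr_norml => /andP[h1 _].
  have := hrho t tT; rewrite mulrC ler_pdivlMr// => h2.
  by lra.
Qed.

(** The expectation of the sum is at most B m, so Markov's inequality applies. *)
Lemma loglik_sum_likely (B C : R) : 0 < C ->
  (forall j, ('E_P[fun w => `|ln (lik (M := M) theta0 (J j) w)|%R] <= B%:E)%E) ->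
  likely P (B / C) [set w | \sum_(j < m) `|ln (lik (M := M) theta0 (J j) w)| <= C * m%:R].
Proof.
move=> C0 hB.
have mR : 0 < m%:R :> R by rewrite ltr0n.
pose X w := \sum_(j < m) `|ln (lik (M := M) theta0 (J j) w)|.
have mXj j : measurable_fun [set: Omega M] (fun w => `|ln (lik (M := M) theta0 (J j) w)|).
  move=> _ D mD; rewrite setTI; apply: (measurable_data gM) => w w' ww'.
  by rewrite /preimage /= (lik_data _ (J j) ww').
have mX : measurable_fun [set: Omega M] X by exact: measurable_sum.
have X0 w : 0 <= X w by exact: sumr_ge0.
pose X' : {mfun (Omega M) >-> R} := mfun_Sub (mem_set mX).
have Cm0 : 0 < C * m%:R by rewrite mulr_gt0.
have := @markov _ _ _ P X' id (C * m%:R) Cm0 (@measurable_id _ _ _) (fun r h => h) (fun x y _ _ h => h).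
set D := [set w | _]%E.
have mD : measurable D.
  apply: (measurable_data gM) => w w' ww'; rewrite /D /= /X.
  by under eq_bigr do rewrite (lik_data _ _ ww').
move=> PD.
have EX : ('E_P[id \o (fun x : R => `|x|%R) \o X'] <= (m%:R * B)%:E)%E.
  rewrite unlock (eq_integral (fun w => \sum_(j < m) (`|ln (lik (M := M) theta0 (J j) w)|)%:E)%E); last first.
    by move=> w _; rewrite /= ger0_norm// /X sumEFin.
  rewrite ge0_integral_sum//; last by move=> j; exact/measurable_EFinP.
  apply: (@le_trans _ _ (\sum_(j < m) B%:E)%E).
    by apply: lee_sum => j _; have := hB j; rewrite unlock.
  by rewrite sumEFin sumr_const card_ord mulr_natl.
exists D; split => //.
- move: (le_trans PD EX); rewrite -lee_pdivlMl// => /le_trans; apply.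
  rewrite -EFinM lee_fin le_eqVlt; apply/orP; left; apply/eqP.
  by field; rewrite !gt_eqF.
- move=> w nD; rewrite /= leNgt; apply/negP => XC; apply: nD.
  by rewrite /D /= lee_fin ger0_norm ?X0// ltW.
Qed.

(** Each cluster equal to t contributes at most - gamma to the log-likelihood of theta, and
    any other cluster at most 0, mass functions being at most 1; the log-likelihood
    of theta0 costs C per cluster. *)
Lemma far_logratio (gamma rho C : R) theta t w : Theta theta -> 0 <= gamma ->
  (forall j, ln (pj theta j t) <= - gamma) ->
  rho * m%:R <= \sum_(j < m) (W j w == t)%:R ->
  \sum_(j < m) `|ln (lik (M := M) theta0 (J j) w)| <= C * m%:R ->
  \sum_(j < m) logratio theta theta0 (J j) w <= - gamma * (rho * m%:R) + C * m%:R.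
Proof.
move=> Tt g0 hg hf hC.
under eq_bigr do rewrite (logratioE gM)//.
rewrite sumrB; apply: lerD; last first.
  rewrite -sumrN; apply: le_trans hC; apply: ler_sum => j _.
  by rewrite (le_trans (ler_norm _))// normrN.
apply: (@le_trans _ _ (\sum_(j < m) - gamma * (W j w == t)%:R)); last first.
  by rewrite -mulr_sumr !mulNr lerN2 ler_wpM2l.
apply: ler_sum => j _.
case: eqP => [wt|_]; first by rewrite mulr1; have := hg j; rewrite -wt.
rewrite mulr0 ln_le0// /lik /=.
exact: (vpmf_le1 (glmm_countable gM) (glmm_values gM)).
Qed.

End FarClusters.

Section FarShells.
Context {R : realType} {p q : nat} {e : bool}.
Local Notation d := (p + (e + q))%N.
Variables (M : forall N, glmm R p q e N) (Theta : set 'rV[R]_d) (theta0 : 'rV[R]_d).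
Hypothesis cT : convex_set Theta.
Hypothesis gM : forall N, is_glmm Theta (M N).
Hypothesis I0 : interior Theta theta0.

Let T0 : Theta theta0 := interior_subset I0.

(** In the k-th shell the full log-likelihood has gradient of order bk cN, so that a net
    of mesh of order 1 / (bk cN) reduces the shell to its points.  They number at most
    of order k^d1 (bk cN)^d, where d1 is 0 in dimension one and d otherwise, and each beats
    theta0 with probability of order exp (- delta m gamma_k), by the subset argument and
    [far_logratio].  The total over the shells is the series assumed to be small. *)
Lemma shells_likely (bk cN : nat -> R) (tau : R) : 0 < tau ->
  C1 M Theta theta0 bk cN -> C2 M Theta theta0 bk cN ->
  exists K2 : nat, \forall N \near \oo, likely (P0 M theta0 N) tau
    [set w | forall theta, Theta theta -> K2%:R <= enorm theta ->
       lik theta id w < lik theta0 id w].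
Proof.
move=> tau0 [zeta [[bk1 cN1] hzeta hpd hgrad]].
move=> [m [len [J [T [gamma [rho [delta [K [B []]]]]]]]]].
move=> hI hE [g0 goo hTv hTk] [rho0 hrho] [hT K1 drho hser].
have tau4 : 0 < tau / 4 by rewrite divr_gt0.
(* the frequency of t may fall from rho to rho', and the rate rho' - delta is left to
   absorb the log-likelihood of theta0 *)
pose rho' := (rho + delta) / 2.
have rr : rho' < rho by rewrite /rho' ltr_pdivrMr//; lra.
have dr : delta < rho' by rewrite /rho' ltr_pdivlMr//; lra.
have rr0 : 0 < rho - rho' by rewrite subr_gt0.
(* by Markov's inequality the mean of the |log p_theta0| exceeds C' with probability at
   most tau / 4 *)
pose C' := 4 * `|B| / tau + 1.
have C'0 : 0 < C' by rewrite ltr_wpDl// divr_ge0 ?mulr_ge0// ltW.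
(* gamma_k tends to infinity: beyond K2 it outweighs C' *)
have [K2 K2K hK2] : exists2 K2, (K <= K2)%N &
    forall k, (K2 <= k)%N -> C' <= (rho' - delta) * gamma k.
  have /cvgryPge/(_ (C' / (rho' - delta))) := goo.
  move=> [n _ hn]; exists (maxn K n); first exact: leq_maxl.
  move=> k; rewrite geq_max => /andP[_ nk].
  by rewrite mulrC -ler_pdivrMr ?subr_gt0//; exact: hn.
exists K2.
have [C C0 {}hzeta] := hzeta _ tau4.
(* numerical constant of the net sizes, times the loss exp C of passing to a net
   point *)
pose A0 := 2 * (6 * d.+2%:R) ^+ d * expR C.
have A00 : 0 < A0.
  by rewrite /A0 mulr_gt0 ?expR_gt0// mulr_gt0// exprn_gt0// mulr_gt0.
have tauA : 0 < tau / 4 / A0 by rewrite divr_gt0.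
have {}hser := cvge0_near_lt hser tauA.
have tauT : 0 < tau / 4 * (rho - rho') ^+ 2 by rewrite mulr_gt0// exprn_gt0.
have {}hT : \forall N \near \oo,
    (size (finmap.enum_fset (T N)))%:R / (m N)%:R < tau / 4 * (rho - rho') ^+ 2 :> R.
  have /cvgr0Pnorm_lt/(_ _ tauT) := hT.
  by apply: filterS => N; exact: le_lt_trans (ler_norm _).
apply: filterS (filterI hpd (filterI hgrad (filterI hI (filterI hE (filterI hTk
  (filterI hrho (filterI hzeta (filterI hser hT)))))))).
move=> N [{}hpd [{}hgrad [[_ {}hI] [{}hE [{}hTk [{}hrho [{}hzeta [{}hser {}hT]]]]]]]].
pose P := P0 M theta0 N.
pose fl (theta : 'rV[R]_d) := Num.truncn (enorm theta).
have flP theta : shell (fl theta)%:R ((fl theta)%:R + 1) theta.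
  by have := truncn_itv (enorm_ge0 theta); rewrite -natr1.
have flK theta : K2%:R <= enorm theta -> (K2 <= fl theta)%N.
  move=> Kt; have /andP[_] := flP theta; rewrite natr1 => /(le_lt_trans Kt).
  by rewrite ltr_nat ltnS.
have K21 : (1 <= K2)%N by exact: leq_trans K2K.
have [mN0|mN0] := posnP (m N).
  (* without clusters the frequency condition forces T N to be empty, and then no
     parameter is far *)
  exists set0; split; rewrite ?measure0 ?lee_fin ?(ltW tau0)// => w _ theta Tt Kt.
  have [t tT _] := hTk (fl theta) theta (leq_trans K21 (flK _ Kt)) Tt (flP theta).
  have mV : (m N)%:R^-1 = 0 :> R by rewrite mN0 invr0.
  by have := hrho t tT; rewrite mV mul0r leNgt rho0.
have mR : 0 < (m N)%:R :> R by rewrite ltr0n.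
have bk0 k : 0 < bk k by exact: lt_le_trans (bk1 k).
have cN0 : 0 < cN N by exact: lt_le_trans (cN1 N).
pose h k := d.+2%:R^-1 / (bk k * cN N).
have bc1 k : 1 <= bk k * cN N by rewrite -[1]mul1r ler_pM.
have bc0 k : 0 < bk k * cN N by rewrite mulr_gt0.
have hd k : h k <= d.+2%:R^-1 by rewrite /h ler_pdivrMr// ler_peMr// invr_ge0.
have h01 k : 0 < h k <= 1.
  by rewrite divr_gt0 ?invr_gt0//= (le_trans (hd k))// invf_le1// ler1n.
pose A k := [set theta | Theta theta /\ shell k%:R (k%:R + 1) theta].
have /choice[net hnet] k : exists s : seq 'rV[R]_d, (1 <= k)%N ->
    [/\ {in s, forall y, A k y},
      (size s)%:R <= 2 * (6 / h k) ^+ d * k%:R ^+ (d * (1 < d)%N) &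
      forall x, A k x -> exists2 y, y \in s & `|x - y| <= h k].
  have [k1|k1] := posnP k; first by exists [::]; rewrite k1.
  by have [s hs] := shell_net k1 (h01 k) (fun x (Ax : A k x) => Ax.2); exists s.
pose E k theta := [set w : Omega (M N) |
  \sum_(j < m N) logratio theta theta0 (J N j) w <= - delta * (m N)%:R * gamma k /\
  lik theta0 id w <= expR C * lik theta id w].
have mE k theta : measurable (E k theta).
  apply: (measurable_data (gM N)) => w w' ww'.
  rewrite /E /= !(lik_data _ id ww') (eq_bigr (fun j => logratio theta theta0 (J N j) w'))//.
  by move=> j _; exact: logratio_data.
pose u k := k%:R ^+ (d * (1 < d)%N) * bk k ^+ d * expR (- delta * (m N)%:R * gamma k).
have u0 k : 0 <= u k.
  by rewrite /u mulr_ge0 ?expR_ge0// mulr_ge0 ?exprn_ge0// ltW.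
pose F k := [set w | exists2 theta, theta \in net k & E k theta w].
have mF k : measurable (F k) by exact: measurable_exists_seq.
have PF k : (K2 <= k)%N -> (P (F k) <= (A0 * cN N ^+ d * u k)%:E)%E.
  move=> kK; have [netA netsz _] := hnet k (leq_trans K21 kK).
  have PE theta : theta \in net k ->
      (P (E k theta) <= (expR C * expR (- delta * (m N)%:R * gamma k))%:E)%E.
    move=> /netA[Tt _].
    exact: (lik_subset_argument (gM N) (- delta * (m N)%:R * gamma k) Tt T0
      (expR_ge0 C) (hI _ Tt) (hI _ T0)).
  apply: (le_trans (union_bound (mE k) PE)); rewrite lee_fin.
  apply: (@le_trans _ _ (2 * (6 / h k) ^+ d * k%:R ^+ (d * (1 < d)%N) *
      (expR C * expR (- delta * (m N)%:R * gamma k)))).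
    by rewrite ler_wpM2r// mulr_ge0// expR_ge0.
  rewrite (_ : 6 / h k = 6 * d.+2%:R * (bk k * cN N)); last first.
    by rewrite /h; field; rewrite !gt_eqF.
  rewrite exprMn (exprMn _ (bk k)) /A0 /u le_eqVlt; apply/orP; left; apply/eqP.
  by ring.
pose Fs := \bigcup_(k in [set k | (K2 <= k)%N]) F k.
have lF : likely P (tau / 4) [set w | ~ Fs w].
  exists Fs; split=> //; first exact: bigcup_measurable.
  have A1 : 0 <= A0 * cN N ^+ d by rewrite mulr_ge0 ?(ltW A00)// exprn_ge0// ltW.
  have := @series_union_bound R _ _ P F u (A0 * cN N ^+ d) K K2 K2K mF u0 A1 PF.
  rewrite -/Fs => /le_trans; apply.
  rewrite EFinM -muleA -lee_pdivlMl// -EFinM mulrC; exact: ltW.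
have lfreq : likely P (tau / 4) [set w | forall t, t \in finmap.enum_fset (T N) ->
    rho' * (m N)%:R <= \sum_(j < m N) (subvector (resp (M N)) (J N j) w == t)%:R].
  apply: le_likely (frequency_likely (gM N) mN0 (hI _ T0) hrho rr).
  by rewrite ler_pdivrMr ?exprn_gt0// ltW.
have lsum : likely P (tau / 4) [set w |
    \sum_(j < m N) `|ln (lik (M := M N) theta0 (J N j) w)| <= C' * (m N)%:R].
  apply: le_likely (loglik_sum_likely (gM N) mN0 C'0 hE).
  rewrite ler_pdivrMr// (le_trans (ler_norm B))// /C' mulrDr mulr1.
  rewrite (_ : tau / 4 * (4 * `|B| / tau) = `|B|); last by field; rewrite gt_eqF.
  by rewrite lerDl ltW.
have lz : likely P (tau / 4) [set w | zeta N w <= C].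
  exists [set w | ((C * 1)%:E < `|(zeta N w)%:E|)%E]; split => //.
    have mz : measurable_fun [set: Omega (M N)] (fun w => `|zeta N w|).
      exact: measurableT_comp.
    have := mz measurableT `]C * 1, +oo[%classic (measurable_itv _).
    rewrite setTI; congr (measurable _); apply/seteqP; split => w /=;
      by rewrite in_itv /= andbT lte_fin.
  move=> w /negP; rewrite -leNgt lee_fin mulr1; exact: le_trans (ler_norm _).
have lgrad : likely P 0 [set w | forall k, (1 <= k)%N ->
    (ereal_sup [set (max_partial Theta (full_loglik w) theta)%:E |
       theta in Theta `&` shell (k%:R - 1) (k%:R + 2)] <=
     (bk k * cN N * zeta N w)%:E)%E].
  have [A1 [mA A10 sA]] := hgrad; exists A1; split => //; first by rewrite A10.
  by move=> w nA; apply: contrapT => nw; apply: nA; exact: sA.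
have := likelyI (likelyI (likelyI (likelyI lF lfreq) lsum) lz) lgrad.
rewrite (_ : _ + _ = tau); last by field.
apply: sub_likely => w [[[[nF fw] sw] zw] gw] theta Tt Kt.
rewrite ltNge; apply/negP => ge0.
pose k := fl theta.
have kK : (K2 <= k)%N by exact: flK.
have k1 : (1 <= k)%N by exact: leq_trans kK.
have [netA _ netP] := hnet k k1.
have [y ynet ty] := netP theta (conj Tt (flP theta)).
have [Ty ky] := netA y ynet.
apply: nF; exists k => //; exists y => //; split.
  have [t tT tg] := hTk k y k1 Ty ky.
  have := far_logratio (gM N) T0 Ty (ltW (g0 k k1)) tg (fw t tT) sw.
  move=> /le_trans; apply.
  have := hK2 k kK; rewrite -(ler_pM2r mR).
  by lra.
have bL v : Theta v -> enorm (v - theta) <= 1 ->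
    max_partial Theta (full_loglik w) v <= bk k * cN N * C.
  move=> Tv vt; apply: (@le_trans _ _ (bk k * cN N * zeta N w)); last first.
    by rewrite ler_wpM2l// ltW.
  rewrite -lee_fin; apply: le_trans (gw k k1); apply: ereal_sup_ubound.
  exists v => //; split => //.
  have /andP[k_le lt_k] := flP theta; rewrite -/k in k_le lt_k.
  have := enormB v theta; have := enormB theta v.
  rewrite -(enormN (theta - v)) opprB => a b.
  by apply/andP; split; lra.
apply: (lik_near gM Tt Ty _ ge0).
have := ball_lipschitz cT I0 (hpd w) bL Tt Ty (le_trans ty (hd k)).
move=> Ly; apply: (le_trans Ly).
apply: (@le_trans _ _ (bk k * cN N * C * d.+2%:R * `|theta - y|)).
  by rewrite ler_wpM2r// ler_wpM2l ?ler_nat ?leqW// mulr_ge0 ?(ltW C0)// ltW.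
apply: (@le_trans _ _ (bk k * cN N * C * d.+2%:R * h k)).
  by rewrite ler_wpM2l// mulr_ge0// mulr_ge0 ?(ltW C0)// ltW.
rewrite le_eqVlt; apply/orP; left; apply/eqP; rewrite /h.
by field; rewrite !gt_eqF.
Qed.

End FarShells.

(** * Existence of the maximizer and consistency *)

Section Existence.
Context {R : realType} {p q : nat} {e : bool} {N : nat}.
Local Notation d := (p + (e + q))%N.
Variables (Theta : set 'rV[R]_d) (theta0 : 'rV[R]_d) (M : glmm R p q e N).
Hypothesis cT : convex_set Theta.
Hypothesis gM : is_glmm Theta M.

(** A continuous function attains its maximum over the compact box of radius rad around
    theta0.  Outside the box the likelihood is smaller than at theta0, a point of the
    box, so that this maximum is global. *)
Lemma maximizer_exists (rad h L : R) (w : Omega M) : 0 < rad -> rad < h ->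
  (forall x, `|theta0 - x| <= rad -> Theta x) ->
  has_partials Theta (fun theta => ln (lik theta id w)) ->
  (forall x, Theta x -> `|theta0 - x| < h ->
     max_partial Theta (fun theta => ln (lik theta id w)) x <= L) ->
  (forall theta, Theta theta -> rad <= enorm (theta - theta0) ->
     lik theta id w < lik theta0 id w) ->
  exists theta, is_maximizer Theta M (data w) theta.
Proof.
move=> rad0 radh boxT pf bL far.
pose f theta := ln (lik (M := M) theta id w).
pose Box : set 'rV[R]_d :=
  [set v | forall i, `[theta0 0 i - rad, theta0 0 i + rad]%classic (v ord0 i)].
have Box_norm v : Box v -> `|theta0 - v| <= rad.
  move=> Bv; apply: norm_leP; first exact: ltW.
  move=> i; have := Bv i; rewrite /= in_itv /= !mxE => /andP[a b].
  by rewrite ler_norml; apply/andP; split; lra.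
have norm_Box v : `|theta0 - v| <= rad -> Box v.
  move=> vr i; have := le_trans (coord_le_norm (theta0 - v) i) vr.
  rewrite /= in_itv /= !mxE ler_norml => /andP[a b].
  by apply/andP; split; lra.
have B0 : Box theta0 by apply: norm_Box; rewrite subrr normr0 ltW.
have cBox : compact Box.
  apply: (rV_compact (A := fun i => `[theta0 0 i - rad, theta0 0 i + rad]%classic)).
  by move=> i; exact: segment_compact.
have fBox : {within Box, continuous f}.
  apply/subspace_continuousP => x Bx; apply/cvgrPdist_lt => eps eps0.
  have Tx := boxT _ (Box_norm _ Bx).
  have [r r0 hr] := within_continuous_at pf bL Tx (le_lt_trans (Box_norm _ Bx) radh) eps0.
  apply/nbhs_ballP; exists r => // y; rewrite mx_norm_ball /ball_ /= => xy By.
  by apply: hr => //; apply: boxT; exact: Box_norm.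
have [c] := EVT_max_rV (ex_intro _ _ B0) cBox fBox.
move=> /set_mem Bc maxc; have Tc := boxT _ (Box_norm _ Bc).
have cmax t : Box t -> lik (M := M) t id w <= lik c id w.
  move=> Bt; have Tt := boxT _ (Box_norm _ Bt).
  by rewrite -ler_ln ?posrE ?(lik_gt0 gM)//; apply/maxc/mem_set.
exists c; split=> // theta Ttheta.
change (lik (M := M) theta id w <= lik c id w).
have [far_theta|near_theta] := leP rad (enorm (theta - theta0)).
  exact: le_trans (ltW (far _ Ttheta far_theta)) (cmax _ B0).
apply/cmax/norm_Box; rewrite distrC; apply: (le_trans (norm_le_enorm _)).
exact: ltW.
Qed.

End Existence.

Theorem theorem5 (R : realType) (p q : nat) (e : bool) (nb : nat)
    (Theta : set 'rV[R]_(p + (e + q))) (theta0 : 'rV[R]_(p + (e + q)))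
    (M : forall N : nat, glmm R p q e N)
    (S : forall N : nat, 'I_nb.+1 -> subset_clusters N)
    (bk cN : nat -> R)
    (mle : forall N : nat, {ffun 'I_N -> R} -> 'rV[R]_(p + (e + q))) :
  convex_set Theta ->
  (forall N : nat, is_glmm Theta (M N)) ->
  A1 M Theta S ->
  (forall r : R, 0 < r -> B2 M Theta theta0 S r /\ B3 M Theta theta0 S r) ->
  C1 M Theta theta0 bk cN ->
  C2 M Theta theta0 bk cN ->
  (forall N : nat, is_mle Theta (M N) (mle N)) ->
  consistent M theta0 mle.
Proof.
move=> cT gM hA1 hB hC1 hC2 hmle eps eps0.
have I0 : interior Theta theta0 := (hB 1 ltr01).1.1.
have T0 : Theta theta0 := interior_subset I0.
apply: near_le_cvge0 => [N|tau tau0]; first exact: measure_ge0.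
have tau3 : 0 < tau / 3 by rewrite divr_gt0.
have [e1 e10 ballT] := (interior_ball Theta theta0).1 I0.
set d := (p + (e + q))%N in Theta theta0 mle cT hB hC1 hC2 hmle I0 T0 ballT gM hA1 *.
(* the sup norm ball of radius rad is in Theta, an estimate further than eps from theta0
   is further than rad, and the sup norm ball of radius 2 rad lies within Euclidean distance 1
   of theta0, where gradients are bounded *)
pose rad := Num.min (e1 / 2) (Num.min eps (2 * d.+1%:R)^-1).
have rad0 : 0 < rad by rewrite !lt_min divr_gt0// eps0 invr_gt0 mulr_gt0.
have [K2 hfar] := shells_likely cT gM I0 tau3 hC1 hC2.
(* parameters of norm below K2 are within r of theta0, and 1 <= r bounds the mesh *)
pose r : R := K2%:R + enorm theta0 + 1.
have r1 : 1 <= r by rewrite lerDr addr_ge0// enorm_ge0.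
have r0 : 0 < r by exact: lt_le_trans r1.
have r20 : 0 < r + 1 by rewrite addr_gt0.
have hann := annulus_likely cT gM I0 hA1 r1 rad0 tau3 (hB r r0).1 (hB (r + 1) r20).2.
have [s [_ [_ hpd [hbd _] _ _]]] := (hB (r + 1) r20).2.
have [C C0 {}hbd] := hbd _ tau3.
apply: filterS (filterI hfar (filterI hann (filterI hpd hbd))).
move=> N [{}hfar [{}hann [{}hpd {}hbd]]].
pose P := P0 M theta0 N.
pose D := [set w : Omega (M N) | ((C * s N)%:E < `|ereal_sup
  [set (max_partial Theta (full_loglik w) theta)%:E |
   theta in nearby Theta theta0 (r + 1)]|)%E].
have mD : measurable D by exact: (measurable_full_sup gM).
have lD : likely P (tau / 3) [set w | ~ D w] by exists D; split.
have := likelyI (likelyI hfar hann) lD.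
rewrite (_ : _ + _ = tau); last by field.
move=> [B [mB PB good]]; apply: le_trans PB; apply: le_probability => //.
  by apply: (measurable_data (gM N)) => w w' ww' /=; rewrite ww'.
move=> w /= est_far; apply: contrapT => /good[[gfar gann] gD].
have far theta : Theta theta -> rad <= enorm (theta - theta0) ->
    lik (M := M N) theta id w < lik theta0 id w.
  move=> Tt tr; have [Kt|Kt] := leP K2%:R (enorm theta); first exact: gfar.
  apply: gann => //; split => //.
  rewrite (le_trans (enormD _ _))// enormN /r; lra.
have radT x : `|theta0 - x| <= rad -> Theta x.
  move=> xr; apply: ballT; apply: (le_lt_trans xr).
  apply: (@le_lt_trans _ _ (e1 / 2)); first by rewrite ge_min lexx.
  by rewrite ltr_pdivrMr// ltr_pMr// ltr1n.
have rad2 : rad < 2 * rad by rewrite ltr_pMl// ltr1n.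
have grad x : Theta x -> `|theta0 - x| < 2 * rad ->
    max_partial Theta (full_loglik w) x <= C * s N.
  move=> Tx xr; apply: (ereal_sup_bound (f := max_partial Theta (full_loglik w)) gD).
  split => //; apply: (@le_trans _ _ 1); last by rewrite lerDr ltW.
  apply: (le_trans (enorm_le_norm _)); rewrite distrC.
  apply: (@le_trans _ _ (d.+1%:R * (2 * (2 * d.+1%:R)^-1))); last first.
    by rewrite invfM mulVKf ?pnatr_eq0// mulfV ?pnatr_eq0.
  apply: ler_pM => //; first by rewrite ler_nat.
  rewrite (le_trans (ltW xr))// ler_wpM2l//.
  by rewrite !ge_min lexx !orbT.
have [est_T est_max] := hmle N (data w)
  (maximizer_exists (gM N) rad0 rad2 radT (hpd w).1 grad far).
have est_rad : rad <= enorm (mle N (data w) - theta0).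
  by rewrite (le_trans _ (ltW est_far))// !ge_min lexx orbT.
have := far _ est_T est_rad; rewrite ltNge; apply/negP; rewrite negbK.
exact: est_max.
Qed.
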